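(* Let $\mathcal{A}$ be a finite-dimensional weak Hopf algebra over $\mathbb{C}$ such that $\mathcal{A}^*$ is semisimple and spherical, let $k\in\mathcal{A}^*$ be a spherical element of $\mathcal{A}^*$ and $\xi_a\in\mathbb{C}$ with $\psi_a(k)=\xi_a\psi_a(g)$ for all $a$. Define $\Omega\in\mathcal{A}$ by $$f(\Omega)=\sum_{a\in\mathrm{Irr}(\mathcal{A}^* )}\frac{1}{\sum_{x:\,l_x=l_a}d_x^2}\cdot\frac{d_a}{\xi_a}\,\mathrm{Tr}\,\psi_a(f)\qquad(f\in\mathcal{A}^* ).$$ Then $\Omega$ is non-degenerate and cocommutative, $\Omega^2=\Omega$, and there exists a linear map $T:\mathcal{A}\to\mathcal{A}$ such that for all $x\in\mathcal{A}$: $(1\otimes x)\Delta(\Omega)=(T(x)\otimes1)\Delta(\Omega)$ and $\Delta(T(x))=\sum k^{-1}(x_{(2)})T(x_{(3)})\otimes T(x_{(1)})$ (i.e. $\Delta\circ T=(T\otimes k^{-1}\otimes T)\circ\Delta^2_{\mathrm{op}}$). Moreover $$\sum T(\Omega_{(1)})\,k^{-1}(\Omega_{(2)})=S(\Omega)=\Omega .$$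
   Context: Weak Hopf algebra: a finite-dimensional unital algebra $\mathcal{A}$ with coassociative counital coproduct $\Delta$ (Sweedler notation), counit $\epsilon$, $\Delta(xy)=\Delta(x)\Delta(y)$, $\Delta^2(1)=(1\otimes\Delta(1))(\Delta(1)\otimes1)=(\Delta(1)\otimes1)(1\otimes\Delta(1))$, $\epsilon(xyz)=\sum\epsilon(xy_{(1)})\epsilon(y_{(2)}z)=\sum\epsilon(xy_{(2)})\epsilon(y_{(1)}z)$, and antipode $S$ with $\sum S(x_{(1)})x_{(2)}=\sum 1_{(1)}\epsilon(x1_{(2)})$, $\sum x_{(1)}S(x_{(2)})=\sum\epsilon(1_{(1)}x)1_{(2)}$, $\sum S(x_{(1)})x_{(2)}S(x_{(3)})=S(x)$. $\Delta^2_{\mathrm{op}}(x)=\sum x_{(3)}\otimes x_{(2)}\otimes x_{(1)}$. The dual $\mathcal{A}^*$ is a weak Hopf algebra with product $(fg)(x)=\sum f(x_{(1)})g(x_{(2)})$, unit $\epsilon$, coproduct $\Delta(f)(x\otimes y)=f(xy)$, antipode $S(f)=f\circ S$. Non-degenerate: $\{(f\otimes\mathrm{Id})\Delta(x)\}=\{(\mathrm{Id}\otimes f)\Delta(x)\}=\mathcal{A}$. For $a\in\mathrm{Irr}(\mathcal{A}^* )$ fix irreps $\psi_a:\mathcal{A}^*\to\mathrm{End}(W_a)$. $N_{ab}^c$ = multiplicity of $\psi_c$ in $f\mapsto(\psi_a\otimes\psi_b)(\Delta f)$ restricted to the range of $(\psi_a\otimes\psi_b)(\Delta\epsilon)$;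 fusion tensors $V^{c\mu}_{ab},W^{c\mu}_{ab}$ with $(\psi_a\otimes\psi_b)(\Delta f)=\sum_{c,\mu}V^{c\mu}_{ab}\psi_c(f)W^{c\mu}_{ab}$, $W^{c\mu}_{ab}V^{d\nu}_{ab}=\delta_{cd}\delta_{\mu\nu}\mathrm{id}$. Vacuum: $b_a$ with $f(1)=\sum_a\mathrm{Tr}(b_a\psi_a(f))$, $E=\{a:b_a\ne0\}$, $b_e=v_eu_e$ rank one ($v_e\in W_e,u_e\in W_e^*$); unique $l_a,r_a\in E$ with $N_{ea}^b=\delta_{e,l_a}\delta_{ab}$, $N_{ae}^b=\delta_{e,r_a}\delta_{ab}$. Conjugation: $\bar a$ = class of $f\mapsto\psi_a(Sf)^T$ on $W_a^*$; invertible $Z_a:W_{\bar a}\to W_a^*$ with $\psi_a(Sf)^T=Z_a\psi_{\bar a}(f)Z_a^{-1}$; $w_c\neq0$ defined by $\zeta_c\otimes\theta_c=w_c(u_{r_c}\circ W^{r_c}_{\bar cc})\otimes(V^{r_c}_{\bar cc}v_{r_c})$ where $\zeta_c(\xi\otimes\eta)=(Z_c\xi)(\eta)$ and $(\varphi\otimes\mathrm{id})\theta_c=Z_{\bar c}^{-1}(\varphi)$; $d_a^2=w_aw_{\bar a}$, $d_a=d_{\bar a}$; $g\in\mathcal{A}^*$ with $\psi_a(g)=\frac{d_a}{w_{\bar a}}(Z_a^{-1})^TZ_{\bar a}$. Spherical: $k\in\mathcal{A}^*$ is pivotal if it is invertible, group-like ($\Delta(k)=(k\otimes k)\Delta(\epsilon)=\Delta(\epsilon)(k\otimes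 k)$) and $S^2(f)=kfk^{-1}$ for all $f$. $\mathcal{A}^*$ is spherical with spherical element $k$ if $u_e(v_e)\neq0$ for all $e\in E$ (this is the counit of $\mathcal{A}^*$ evaluated on the central projector onto block $e$), and $k$ is pivotal with $\frac{\mathrm{Tr}\,\psi_a(k)}{u_{l_a}(v_{l_a})}=\frac{\mathrm{Tr}\,\psi_a(k^{-1})}{u_{r_a}(v_{r_a})}$ for all $a\in\mathrm{Irr}(\mathcal{A}^* )$. *)

(* Defs.v *)
From HB Require Import structures.
From mathcomp Require Import all_boot all_order all_algebra.
From mathcomp Require Import complex.
From mathcomp Require Import Rstruct.
Set Implicit Arguments.
Unset Strict Implicit.
Unset Printing Implicit Defensive.
Import Order.TTheory GRing.Theory Num.Theory.
Local Open Scope ring_scope.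

Notation Cplx := (Rdefinitions.R[i]).

(* A weak Hopf algebra structure on C^n, given by its structure constants
   in the standard basis e_0,...,e_{n-1}.  Elements of A are row vectors
   x : 'rV_n (x = \sum_i x_i e_i).  Elements of A (x) A are n x n matrices
   X (X = \sum_{j,k} X j k e_j (x) e_k); elements of A (x) A (x) A are
   matrices T : 'M_(n, n*n) (T = \sum T p (mxvec_index q r) e_p(x)e_q(x)e_r). *)
Record wha (C : fieldType) (n : nat) := WHA {
  wmul : 'I_n -> 'I_n -> 'rV[C]_n;
  wone : 'rV[C]_n;
  wcomul : 'I_n -> 'M[C]_n;
  weps : 'rV[C]_n;                   (* weps 0 i = epsilon(e_i) *)
  wS : 'M[C]_n                       (* row i of wS = S(e_i) *)
}.

Section WHA.
Variables (C : fieldType) (n : nat) (A : wha C n).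

Definition bvec (i : 'I_n) : 'rV[C]_n := delta_mx 0 i.

Definition amul (x y : 'rV[C]_n) : 'rV[C]_n :=
  \sum_i \sum_j (x 0 i * y 0 j) *: wmul A i j.
Definition comul (x : 'rV[C]_n) : 'M[C]_n := \sum_i x 0 i *: wcomul A i.
Definition eps (x : 'rV[C]_n) : C := \sum_i x 0 i * weps A 0 i.
Definition antip (x : 'rV[C]_n) : 'rV[C]_n := x *m wS A.

Definition t2 (x y : 'rV[C]_n) : 'M[C]_n := x^T *m y.
Definition t3 (x y z : 'rV[C]_n) : 'M[C]_(n, n * n) :=
  \sum_p \sum_q \sum_r (x 0 p * y 0 q * z 0 r) *: delta_mx p (mxvec_index q r).

(* Sweedler sums: tsum2 h X = \sum h(X_(1), X_(2)) for a bilinear h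
   (h is evaluated on basis vectors and extended (multi)linearly). *)
Definition tsum2 (V : lmodType C) (h : 'rV[C]_n -> 'rV[C]_n -> V) (X : 'M[C]_n) : V :=
  \sum_j \sum_k X j k *: h (bvec j) (bvec k).
Definition tsum2s (h : 'rV[C]_n -> 'rV[C]_n -> C) (X : 'M[C]_n) : C :=
  \sum_j \sum_k X j k * h (bvec j) (bvec k).
Definition tsum3 (V : lmodType C) (h : 'rV[C]_n -> 'rV[C]_n -> 'rV[C]_n -> V)
   (T : 'M[C]_(n, n * n)) : V :=
  \sum_p \sum_q \sum_r T p (mxvec_index q r) *: h (bvec p) (bvec q) (bvec r).

Definition tmul2 (X Y : 'M[C]_n) : 'M[C]_n :=
  tsum2 (fun a b => tsum2 (fun c d => t2 (amul a c) (amul b d)) Y) X.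
Definition tmul3 (T U : 'M[C]_(n, n * n)) : 'M[C]_(n, n * n) :=
  tsum3 (fun a b c => tsum3 (fun a' b' c' =>
     t3 (amul a a') (amul b b') (amul c c')) U) T.

Definition comul2 (x : 'rV[C]_n) : 'M[C]_(n, n * n) :=
  tsum2 (fun a b => tsum2 (fun p q => t3 p q b) (comul a)) (comul x).
Definition comul2' (x : 'rV[C]_n) : 'M[C]_(n, n * n) :=
  tsum2 (fun a b => tsum2 (fun p q => t3 a p q) (comul b)) (comul x).

Definition is_weak_hopf : Prop :=
  (forall x y z, amul (amul x y) z = amul x (amul y z)) /\
  (forall x, amul (wone A) x = x /\ amul x (wone A) = x) /\
  (forall x, comul2 x = comul2' x) /\
  (forall x, tsum2 (fun a b => eps a *: b) (comul x) = x
          /\ tsum2 (fun a b => eps b *: a) (comul x) = x) /\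
  (forall x y, comul (amul x y) = tmul2 (comul x) (comul y)) /\
  (comul2 (wone A)
     = tmul3 (tsum2 (fun a b => t3 (wone A) a b) (comul (wone A)))
             (tsum2 (fun a b => t3 a b (wone A)) (comul (wone A)))
   /\ comul2 (wone A)
     = tmul3 (tsum2 (fun a b => t3 a b (wone A)) (comul (wone A)))
             (tsum2 (fun a b => t3 (wone A) a b) (comul (wone A)))) /\
  (forall x y z,
      eps (amul (amul x y) z)
        = tsum2s (fun a b => eps (amul x a) * eps (amul b z)) (comul y)
   /\ eps (amul (amul x y) z)
        = tsum2s (fun a b => eps (amul x b) * eps (amul a z)) (comul y)) /\
  (forall x,
      tsum2 (fun a b => amul (antip a) b) (comul x)
        = tsum2 (fun a b => eps (amul x b) *: a) (comul (wone A)) /\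
      tsum2 (fun a b => amul a (antip b)) (comul x)
        = tsum2 (fun a b => eps (amul a x) *: b) (comul (wone A)) /\
      tsum3 (fun a b c => amul (amul (antip a) b) (antip c)) (comul2 x)
        = antip x).

Definition elt_nondegenerate (x : 'rV[C]_n) : Prop :=
  (forall y, exists f : 'rV[C]_n, tsum2 (fun p q => (\sum_i f 0 i * p 0 i) *: q) (comul x) = y)
  /\ (forall y, exists f : 'rV[C]_n, tsum2 (fun p q => (\sum_i f 0 i * q 0 i) *: p) (comul x) = y).

Definition elt_cocommutative (x : 'rV[C]_n) : Prop := (comul x)^T = comul x.

(* ---- The dual A^* ----
   f : 'rV_n represents the functional with f(e_i) = f 0 i. *)
Definition ev (f x : 'rV[C]_n) : C := \sum_i f 0 i * x 0 i.
Definition dmul (f g : 'rV[C]_n) : 'rV[C]_n :=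
  \row_i tsum2s (fun a b => ev f a * ev g b) (comul (bvec i)).
Definition dunit : 'rV[C]_n := weps A.
(* elements F of A^* (x) A^* as matrices, F i j = F(e_i (x) e_j) *)
Definition dcomul (f : 'rV[C]_n) : 'M[C]_n := \matrix_(i, j) ev f (amul (bvec i) (bvec j)).
Definition dt2 (f g : 'rV[C]_n) : 'M[C]_n := f^T *m g.
Definition ev2 (F : 'M[C]_n) (x y : 'rV[C]_n) : C := (x *m F *m y^T) 0 0.
Definition dtmul (F G : 'M[C]_n) : 'M[C]_n :=
  \matrix_(i, j) tsum2s (fun a b => tsum2s (fun c d => ev2 F a c * ev2 G b d)
                                          (comul (bvec j))) (comul (bvec i)).
Definition dS (f : 'rV[C]_n) : 'rV[C]_n := \row_i ev f (antip (bvec i)).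

Definition left_ideal (L : 'M[C]_n) : Prop :=
  forall f g : 'rV[C]_n, (g <= L)%MS -> (dmul f g <= L)%MS.
Definition dual_semisimple : Prop :=
  forall L, left_ideal L ->
    exists L', [/\ left_ideal L', (L :&: L')%MS == 0 & row_full (L + L')%MS].

(* representations of A^* on C^m (matrices act on column vectors) *)
Definition is_alg_rep m (rho : 'rV[C]_n -> 'M[C]_m) : Prop :=
  [/\ (forall c f g, rho (c *: f + g) = c *: rho f + rho g),
      rho dunit = 1%:M &
      (forall f g, rho (dmul f g) = rho f *m rho g)].
Definition irreducible_rep m (rho : 'rV[C]_n -> 'M[C]_m) : Prop :=
  (0 < m)%N /\
  forall U : 'M[C]_m, (forall f, ((rho f *m U)^T <= U^T)%MS) ->
     U == 0 \/ row_full U^T.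
Definition rep_iso m1 m2 (rho1 : 'rV[C]_n -> 'M[C]_m1) (rho2 : 'rV[C]_n -> 'M[C]_m2) : Prop :=
  exists (P : 'M[C]_(m1, m2)) (Q : 'M[C]_(m2, m1)),
    [/\ P *m Q = 1%:M, Q *m P = 1%:M & forall f, rho1 f *m P = P *m rho2 f].

Definition pivotal (k kinv : 'rV[C]_n) : Prop :=
  [/\ dmul k kinv = dunit, dmul kinv k = dunit,
      dcomul k = dtmul (dt2 k k) (dcomul dunit),
      dcomul k = dtmul (dcomul dunit) (dt2 k k) &
      forall f, dS (dS f) = dmul (dmul k f) kinv].

End WHA.

Arguments bvec {C n} i.

Definition kron (C : fieldType) m1 n1 m2 n2 (P : 'M[C]_(m1, n1)) (Q : 'M[C]_(m2, n2))
  : 'M[C]_(m1 * m2, n1 * n2) :=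
  \sum_(i1 < m1) \sum_(j1 < n1) \sum_(i2 < m2) \sum_(j2 < n2)
     (P i1 j1 * Q i2 j2) *: delta_mx (mxvec_index i1 i2) (mxvec_index j1 j2).

Definition tens_rep (C : fieldType) n (A : wha C n) ma mb
   (psia : 'rV[C]_n -> 'M[C]_ma) (psib : 'rV[C]_n -> 'M[C]_mb) (f : 'rV[C]_n)
  : 'M[C]_(ma * mb) :=
  \sum_i \sum_j dcomul A f i j *: kron (psia (bvec i)) (psib (bvec j)).

(* Main.v *)
(* The dual B = A^* is again a weak Hopf algebra, and by semisimplicity it is the
   direct sum of the matrix algebras End(W_a).  The trace lam(f) of x |-> f S^2(x) on B
   satisfies h_1 lam(f h_2) = S(f_1) lam(f_2 h): both sides are the trace of the same
   composite, cut open cyclically.  As S^2 is conjugation by k,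
   lam(f) = sum_a chi_a(k^-1) chi_a(f k), with chi_a = Tr psi_a; so Omega is lam
   multiplied by k^-1 and by a central element z with Delta(z) = (1 (x) z) Delta(1).
   This gives the pulling-through identity with T dual to f |-> S(f) k, and, evaluated on
   characters, the reciprocity N_{ac}^b = N_{a* b}^c.

   The w_c evaluate to D_a := Tr psi_a(k) / u_{l_a}(v_{l_a}) = xi_a d_a = d_a / xi_a,
   hence D_a^2 = d_a^2.  Partial quantum traces of Delta(1) are central, which makes D a
   character of the fusion ring; with reciprocity D is real, so sum_{l_x = e} d_x^2 > 0,
   this sum is the same for e = l_a and e = r_a, and Omega^2 = Omega. *)

(* In the weak setting Delta(1) is not 1 (x) 1 and there may be several vacua, which shapes the
   argument. The correction z can pass through a coproduct because it lies in the base algebra cut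
   out of Delta(1), but a central element of that algebra acts on block a through r_a alone, whereas
   Omega is normalised by l_a. So the equality of the two sums of squared dimensions is needed
   already for pulling through, not only for Omega^2 = Omega. These are sums of squares of complex
   numbers and might vanish a priori; pairing the fusion character D with its own complex conjugate
   excludes this.

   Sphericality enters when D_a is computed twice, from the trace of k and from the trace of k^-1.

   Antimultiplicativity of the dual antipode is read off the conjugation data: psi_a(S f) is the
   transpose of a conjugate of psi_{bar a}(f), and the irreps are jointly faithful. Faithfulness in
   turn uses complements of left ideals to exclude a nonzero ideal killed by all irreps.

   The factor k in T is S(k^-1), left over when k^-1 is pulled out of the coproduct. *)
Require Import Defs.
From HB Require Import structures.
From mathcomp Require Import all_boot all_order all_algebra.
From mathcomp Require Import complex.
From mathcomp Require Import Rstruct.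
From mathcomp Require Import ring.
Set Implicit Arguments.
Unset Strict Implicit.
Unset Printing Implicit Defensive.
Import Order.TTheory GRing.Theory Num.Theory.
Local Open Scope ring_scope.

(** * Multilinear functions and coordinates *)

(* Bodies of tsumC are annotated with [: C]: elaborated at type C^o, a product would use
   the ring structure of the regular module and later rewriting would fail. *)
Notation tsumC := (@tsum2 _ _ (GRing.regular _)).

Section Lin.
Variable C : fieldType.

(** A predicate on bare functions: Sweedler sums are formed from raw lambda terms, and [slin] proves
    linearity by recursion on their syntax. *)
Definition lin (U V : lmodType C) (f : U -> V) : Prop :=
  forall c x y, f (c *: x + y) = c *: f x + f y.

Variables (U V M : lmodType C).

Lemma linD (f : U -> V) : lin f -> forall x y, f (x + y) = f x + f y.
Proof. by move=> Hf x y; have := Hf 1 x y; rewrite !scale1r. Qed.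

Lemma lin0 (f : U -> V) : lin f -> f 0 = 0.
Proof. by move=> Hf; apply: (addrI (f 0)); rewrite -linD // !addr0. Qed.

Lemma linZ (f : U -> V) : lin f -> forall c x, f (c *: x) = c *: f x.
Proof. by move=> Hf c x; have := Hf c x 0; rewrite addr0 (lin0 Hf) addr0. Qed.

Lemma lin_sum (f : U -> V) (J : Type) (s : seq J) (P : pred J) (F : J -> U) :
  lin f -> f (\sum_(i <- s | P i) F i) = \sum_(i <- s | P i) f (F i).
Proof. by move=> Hf; apply: (big_morph f (linD Hf) (lin0 Hf)). Qed.

Lemma lin_id : lin (fun x : U => x).
Proof. by []. Qed.

Lemma lin_comp (g : V -> M) (f : U -> V) : lin g -> lin f -> lin (fun x => g (f x)).
Proof. by move=> Hg Hf c x y; rewrite Hf Hg. Qed.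

Lemma lin_scalel (f : U -> C^o) (v : V) : lin f -> lin (fun x => f x *: v).
Proof. by move=> Hf c x y; rewrite Hf scalerDl scalerA. Qed.

Lemma lin_scaler (f : U -> V) c : lin f -> lin (fun x => c *: f x).
Proof. by move=> Hf c' x y; rewrite Hf scalerDr !scalerA mulrC. Qed.

Lemma lin_mulsl (f : U -> C) c :
  @lin U C^o f -> @lin U C^o (fun x => (f x * c : C)).
Proof. by move=> Hf c' x y; rewrite Hf mulrDl; congr (_ + _); exact/esym/mulrA. Qed.

Lemma lin_mulsr (f : U -> C) c :
  @lin U C^o f -> @lin U C^o (fun x => (c * f x : C)).
Proof. by move=> Hf c' x y; rewrite Hf mulrDr; congr (_ + _); exact: mulrCA. Qed.

Lemma lin_bigsum (J : Type) (s : seq J) (P : pred J) (F : U -> J -> V) :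
  (forall j, lin (fun x => F x j)) -> lin (fun x => \sum_(j <- s | P j) F x j).
Proof.
move=> HF c x y; rewrite scaler_sumr -big_split /=.
by apply: eq_bigr => j _; rewrite (HF j).
Qed.

End Lin.

Section MatrixIndices.
Variable C : fieldType.

(** [mxvec] carries basis matrices to basis rows, so equal indices give equal basis matrices, which
    their entries tell apart. *)
Lemma mxvec_index_eq m p (i i' : 'I_m) (j j' : 'I_p) :
  (mxvec_index i j == mxvec_index i' j') = (i == i') && (j == j').
Proof.
apply/eqP/andP => [H|[/eqP-> /eqP->]] //.
have := f_equal (fun k => (delta_mx 0 k : 'rV[int]_(m * p))) H.
rewrite -!mxvec_delta => /(can_inj (@mxvecK _ _ _)) /matrixP /(_ i j).
rewrite !mxE !eqxx /=; case: eqP => //=; case: eqP => //= _ _ /eqP; by rewrite oner_eq0.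
Qed.

Lemma delta_mx_sandwich m (X : 'M[C]_m) (i p q j : 'I_m) :
  delta_mx i p *m X *m delta_mx q j = X p q *: delta_mx i j.
Proof.
transitivity (delta_mx i (0 : 'I_1) *m (row p X *m delta_mx q (0 : 'I_1)) *m delta_mx 0 j).
  by rewrite rowE !mulmxA mul_delta_mx -(mulmxA _ (delta_mx q 0)) mul_delta_mx.
have -> : row p X *m delta_mx q (0 : 'I_1) = (X p q)%:M.
  by rewrite -colE [LHS]mx11_scalar !mxE.
by rewrite mul_mx_scalar -scalemxAl mul_delta_mx.
Qed.

End MatrixIndices.

Section Coord.
Variables (C : fieldType) (n : nat).
Notation E := 'rV[C]_n.

Lemma bvecE (i j : 'I_n) : (bvec i : E) 0 j = (i == j)%:R.
Proof. by rewrite mxE eqxx eq_sym. Qed.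

Lemma row_expand (x : E) : x = \sum_i x 0 i *: bvec i.
Proof. by rewrite {1}[x]row_sum_delta. Qed.

Lemma lin_expand (V : lmodType C) (f : E -> V) x :
  lin f -> f x = \sum_i x 0 i *: f (bvec i).
Proof.
move=> Hf; rewrite {1}[x]row_expand (lin_sum _ _ _ Hf).
by apply: eq_bigr => i _; rewrite linZ.
Qed.

Lemma eq_lin (V : lmodType C) (f g : E -> V) :
  lin f -> lin g -> (forall i, f (bvec i) = g (bvec i)) -> forall x, f x = g x.
Proof.
move=> Hf Hg H x; rewrite (lin_expand x Hf) (lin_expand x Hg).
by apply: eq_bigr => i _; rewrite H.
Qed.

Lemma lin_coord (i : 'I_n) : @lin C E C^o (fun x : E => (x 0 i : C)).
Proof. by move=> c x y; rewrite !mxE. Qed.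

Lemma lin_ev (f : E) : @lin C E C^o (fun x => (ev f x : C)).
Proof.
by apply: lin_bigsum => j; apply: lin_mulsr; exact: lin_coord.
Qed.

Lemma evC (f x : E) : ev f x = ev x f.
Proof. by apply: eq_bigr => i _; rewrite mulrC. Qed.

Lemma lin_evl (x : E) : @lin C E C^o (fun f => (ev f x : C)).
Proof. by move=> c f g; rewrite !(evC _ x); exact: (lin_ev x). Qed.

Lemma ev_bvec (f : E) i : ev f (bvec i) = f 0 i.
Proof.
rewrite /ev (bigD1 i) //= bvecE eqxx mulr1 big1 ?addr0 // => j jDi.
by rewrite bvecE eq_sym (negbTE jDi) mulr0.
Qed.

Lemma ev_bvecl (x : E) i : ev (bvec i) x = x 0 i.
Proof. by rewrite evC ev_bvec. Qed.

Lemma ev_inj (x y : E) : (forall f, ev f x = ev f y) -> x = y.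
Proof. by move=> H; apply/rowP => i; rewrite -!ev_bvecl H. Qed.

Definition bilin (V : lmodType C) (h : E -> E -> V) : Prop :=
  (forall y, lin (fun x => h x y)) /\ (forall x, lin (h x)).

(** Only values on basis pairs enter a Sweedler sum, so rewriting under it requires no linearity of
    [h]. *)
Lemma eq_tsum2 (V : lmodType C) (h h' : E -> E -> V) X :
  (forall j k, h (bvec j) (bvec k) = h' (bvec j) (bvec k)) -> tsum2 h X = tsum2 h' X.
Proof.
by move=> H; apply: eq_bigr => j _; apply: eq_bigr => k _; rewrite H.
Qed.

Lemma eq_tsum2s (h h' : E -> E -> C) X :
  (forall j k, h (bvec j) (bvec k) = h' (bvec j) (bvec k)) ->
  tsumC h X = tsumC h' X :> C.
Proof. exact: (@eq_tsum2 C^o). Qed.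

Lemma lin_tsum2 (V : lmodType C) (h : E -> E -> V) : lin (tsum2 h).
Proof.
move=> c X Y; rewrite /tsum2 scaler_sumr -big_split /=; apply: eq_bigr => j _.
rewrite scaler_sumr -big_split /=; apply: eq_bigr => k _.
by rewrite !mxE scalerDl scalerA.
Qed.

Lemma lin_tsum2h (U V : lmodType C) (h : U -> E -> E -> V) X :
  (forall a b, lin (fun x => h x a b)) -> lin (fun x => tsum2 (h x) X).
Proof.
by move=> Hh; do 2! [apply: lin_bigsum => ?]; apply: lin_scaler.
Qed.

Lemma tsum2_comp (V M : lmodType C) (f : V -> M) (h : E -> E -> V) X :
  lin f -> f (tsum2 h X) = tsum2 (fun a b => f (h a b)) X.
Proof.
move=> Hf; rewrite /tsum2 (lin_sum _ _ _ Hf); apply: eq_bigr => j _.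
by rewrite (lin_sum _ _ _ Hf); apply: eq_bigr => k _; rewrite linZ.
Qed.

Lemma tsum2_sum (V : lmodType C) (J : finType) (F : J -> E -> E -> V) X :
  tsum2 (fun a b => \sum_t F t a b) X = \sum_t tsum2 (F t) X.
Proof.
rewrite /tsum2; under eq_bigr => i _ do under eq_bigr => j _ do rewrite scaler_sumr.
by under eq_bigr => i _ do rewrite exchange_big /=; rewrite exchange_big.
Qed.

Lemma exchange_tsum2 (V : lmodType C) (h : E -> E -> E -> E -> V) X Y :
  tsum2 (fun a b => tsum2 (fun c d => h a b c d) Y) X
  = tsum2 (fun c d => tsum2 (fun a b => h a b c d) X) Y.
Proof.
rewrite /tsum2.
transitivity (\sum_j \sum_k \sum_p \sum_q (X j k * Y p q) *: h (bvec j) (bvec k) (bvec p) (bvec q)).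
  apply: eq_bigr => j _; apply: eq_bigr => k _; rewrite scaler_sumr; apply: eq_bigr => p _.
  by rewrite scaler_sumr; apply: eq_bigr => q _; rewrite scalerA.
transitivity (\sum_p \sum_q \sum_j \sum_k (X j k * Y p q) *: h (bvec j) (bvec k) (bvec p) (bvec q)).
  under eq_bigr => j _ do rewrite exchange_big.
  rewrite exchange_big; apply: eq_bigr => p _ /=.
  under eq_bigr => j _ do rewrite exchange_big.
  by rewrite exchange_big; apply: eq_bigr.
apply: eq_bigr => j _; apply: eq_bigr => k _; rewrite scaler_sumr; apply: eq_bigr => p _.
by rewrite scaler_sumr; apply: eq_bigr => q _; rewrite scalerA mulrC.
Qed.

Lemma t2E (x y : E) j k : t2 x y j k = x 0 j * y 0 k.
Proof. by rewrite /t2 mxE big_ord1 mxE. Qed.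

Lemma bilin_t2 : bilin (@t2 C n).
Proof.
have scE (c : C) (X Y : 'M[C]_n) i j : (c *: X + Y) i j = c * X i j + Y i j.
  by rewrite !mxE.
by split=> z c x y; apply/matrixP => i j; rewrite scE !t2E !mxE;
  rewrite ?mulrDl ?mulrDr -?mulrA // mulrCA.
Qed.

Lemma tsum2_t2 (V : lmodType C) (h : E -> E -> V) x y : bilin h -> tsum2 h (t2 x y) = h x y.
Proof.
move=> [hl hr]; rewrite (lin_expand x (hl y)); apply: eq_bigr => j _.
rewrite (lin_expand y (hr _)) scaler_sumr; apply: eq_bigr => k _.
by rewrite t2E scalerA.
Qed.

Lemma tsum2_t2id X : tsum2 (@t2 C n) X = X.
Proof.
apply/matrixP => i j; rewrite /tsum2 summxE (bigD1 i) //= summxE (bigD1 j) //=.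
rewrite mxE t2E !bvecE !eqxx !mulr1 big1 ?addr0 => [|k kj]; last first.
  by rewrite mxE t2E !bvecE (negbTE kj) !mulr0.
rewrite big1 ?addr0 // => k ki; rewrite summxE big1 // => p _.
by rewrite mxE t2E !bvecE (negbTE ki) mul0r !mulr0.
Qed.

Lemma tsum2E (h : E -> E -> 'M[C]_n) X i j :
  tsum2 h X i j = tsumC (fun a b => (h a b i j : C)) X.
Proof. by rewrite (tsum2_comp (M := C^o) (f := fun Y : 'M[C]_n => (Y i j : C))) // => c x y; rewrite !mxE. Qed.

Definition trilin (V : lmodType C) (h : E -> E -> E -> V) : Prop :=
  [/\ forall y z, lin (fun x => h x y z), forall x z, lin (fun y => h x y z)
    & forall x y, lin (h x y)].

Lemma t3E (x y z : E) p q r : t3 x y z p (mxvec_index q r) = x 0 p * y 0 q * z 0 r.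
Proof.
rewrite /t3 summxE (bigD1 p) //= summxE (bigD1 q) //= summxE (bigD1 r) //=.
rewrite !mxE !eqxx mulr1 big1 ?addr0 => [|k kr]; last first.
  by rewrite !mxE mxvec_index_eq eqxx eq_sym (negbTE kr) !andbF mulr0.
rewrite big1 ?addr0 => [|k kr]; last first.
  by rewrite summxE big1 // => s _; rewrite !mxE mxvec_index_eq [q == _]eq_sym (negbTE kr) !andbF mulr0.
rewrite big1 ?addr0 // => k kr.
by rewrite summxE big1 // => s _; rewrite summxE big1 // => t _; rewrite !mxE eq_sym (negbTE kr) mulr0.
Qed.

Lemma mx3P (T U : 'M[C]_(n, n * n)) :
  (forall p q r, T p (mxvec_index q r) = U p (mxvec_index q r)) -> T = U.
Proof. by move=> H; apply/matrixP => p k; case: (mxvec_indexP k) => q r; exact: H. Qed.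

Lemma lin_tsum3 (V : lmodType C) (h : E -> E -> E -> V) : lin (tsum3 h).
Proof.
move=> c X Y; rewrite /tsum3 scaler_sumr -big_split /=; apply: eq_bigr => p _.
rewrite scaler_sumr -big_split /=; apply: eq_bigr => q _.
rewrite scaler_sumr -big_split /=; apply: eq_bigr => r _.
by rewrite !mxE scalerDl scalerA.
Qed.

Lemma tsum3_comp (V M : lmodType C) (f : V -> M) (h : E -> E -> E -> V) X :
  lin f -> f (tsum3 h X) = tsum3 (fun a b c => f (h a b c)) X.
Proof.
move=> Hf; rewrite /tsum3 (lin_sum _ _ _ Hf); apply: eq_bigr => j _.
rewrite (lin_sum _ _ _ Hf); apply: eq_bigr => k _.
by rewrite (lin_sum _ _ _ Hf); apply: eq_bigr => p _; rewrite linZ.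
Qed.

Lemma tsum3_t3 (V : lmodType C) (h : E -> E -> E -> V) x y z :
  trilin h -> tsum3 h (t3 x y z) = h x y z.
Proof.
move=> [h1 h2 h3]; rewrite (lin_expand x (h1 y z)); apply: eq_bigr => p _.
rewrite (lin_expand y (h2 _ z)) scaler_sumr; apply: eq_bigr => q _.
rewrite (lin_expand z (h3 _ _)) !scaler_sumr; apply: eq_bigr => r _.
by rewrite t3E !scalerA.
Qed.

(* A function is evaluated on basis vectors only, so no linearity is required here. *)
Lemma tsum3_t3b (V : lmodType C) (h : E -> E -> E -> V) i j k :
  tsum3 h (t3 (bvec i) (bvec j) (bvec k)) = h (bvec i) (bvec j) (bvec k).
Proof.
rewrite /tsum3 (bigD1 i) //= (bigD1 j) //= (bigD1 k) //= t3E !bvecE !eqxx !mulr1 scale1r.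
rewrite big1 ?addr0 => [|s sk]; last by rewrite t3E !bvecE [k == _]eq_sym (negbTE sk) mulr0 scale0r.
rewrite big1 ?addr0 => [|s sk]; last first.
  by rewrite big1 // => t _; rewrite t3E !bvecE [j == _]eq_sym (negbTE sk) mulr0 mul0r scale0r.
rewrite big1 ?addr0 // => s sk.
by rewrite big1 // => u _; rewrite big1 // => t _; rewrite t3E !bvecE [i == _]eq_sym (negbTE sk) !mul0r scale0r.
Qed.

End Coord.

(** * Sweedler calculus in a weak Hopf algebra *)

Section StructureMaps.
Variables (C : fieldType) (n : nat) (H : wha C n).
Notation E := 'rV[C]_n.

Lemma lin_amull (y : E) : lin (fun x => amul H x y).
Proof.
move=> c x z; rewrite /amul scaler_sumr -big_split /=; apply: eq_bigr => i _.
rewrite scaler_sumr -big_split /=; apply: eq_bigr => j _.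
by rewrite !mxE mulrDl scalerDl scalerA mulrA.
Qed.

Lemma lin_amulr (x : E) : lin (amul H x).
Proof.
move=> c y z; rewrite /amul scaler_sumr -big_split /=; apply: eq_bigr => i _.
rewrite scaler_sumr -big_split /=; apply: eq_bigr => j _.
by rewrite !mxE mulrDr scalerDl scalerA mulrCA.
Qed.

Lemma lin_comul : lin (comul H).
Proof.
move=> c x y; rewrite /comul scaler_sumr -big_split /=; apply: eq_bigr => i _.
by rewrite !mxE scalerDl scalerA.
Qed.

Lemma lin_eps : @lin C E C^o (fun x => (eps H x : C)).
Proof.
by apply: lin_bigsum => i; apply: lin_mulsl; exact: lin_coord.
Qed.

Lemma lin_antip : lin (antip H).
Proof. by move=> c x y; rewrite /antip mulmxDl -scalemxAl. Qed.

End StructureMaps.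

(** Each branch peels one known linear map off the body by [lin_comp]; [bilin], [trilin] and [lin]
    hypotheses cover variables, and the last branch eta-expands. *)
Ltac slin1 :=
  match goal with
  | |- forall _, _ => intro
  | |- bilin _ => split
  | |- trilin _ => split
  | |- lin (fun x => x) => exact: lin_id
  | |- lin (fun x => amul ?H (@?f x) ?y) =>
      refine (@lin_comp _ _ _ _ (fun z => amul H z y) f (lin_amull H y) _)
  | |- lin (fun x => amul ?H ?y (@?f x)) =>
      refine (@lin_comp _ _ _ _ (amul H y) f (lin_amulr H y) _)
  | |- lin (fun x => antip ?H (@?f x)) =>
      refine (@lin_comp _ _ _ _ (antip H) f (lin_antip H) _)
  | |- lin (fun x => @tsum2 ?C ?n ?V (@?h x) ?X) =>
      refine (@lin_tsum2h C n _ V h X _)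
  | |- lin (fun x => @tsum2 ?C ?n ?V ?h (comul ?H (@?X x))) =>
      refine (@lin_comp C _ _ V (fun z => @tsum2 C n V h (comul H z)) X
                (lin_comp (@lin_tsum2 C n V h) (lin_comul H)) _)
  | |- lin (fun x => (@?f x) *: ?v) => refine (@lin_scalel _ _ _ f v _)
  | |- lin (fun x => ?c *: (@?f x)) => refine (@lin_scaler _ _ _ f c _)
  | |- lin (fun x => (@?f x) * ?v) => refine (@lin_mulsl _ _ f v _)
  | |- lin (fun x => ?c * (@?f x)) => refine (@lin_mulsr _ _ f c _)
  | |- lin (fun x => eps ?H (@?f x)) =>
      refine (@lin_comp _ _ _ (GRing.regular _) (fun z => eps H z) f (lin_eps H) _)
  | |- lin (fun x => ev ?g (@?f x)) =>
      refine (@lin_comp _ _ _ (GRing.regular _) (fun z => ev g z) f (lin_ev g) _)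
  | |- lin (fun x => ev (@?f x) ?g) =>
      refine (@lin_comp _ _ _ (GRing.regular _) (fun z => ev z g) f (lin_evl g) _)
  | |- lin (fun x => fun_of_matrix (@?f x) _ ?i) =>
      refine (@lin_comp _ _ _ _ _ f (lin_coord i) _)
  | |- lin (fun x => t2 (@?f x) ?y) =>
      refine (@lin_comp _ _ _ _ (fun z => t2 z y) f (proj1 (bilin_t2 _ _) y) _)
  | |- lin (fun x => t2 ?y (@?f x)) =>
      refine (@lin_comp _ _ _ _ (t2 y) f (proj2 (bilin_t2 _ _) y) _)
  | Hh : bilin ?h |- lin (fun x => ?h (@?f x) ?y) =>
      refine (@lin_comp _ _ _ _ (fun z => h z y) f (proj1 Hh y) _)
  | Hh : bilin ?h |- lin (fun x => ?h ?y (@?f x)) =>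
      refine (@lin_comp _ _ _ _ (h y) f (proj2 Hh y) _)
  | Hh : trilin ?h |- lin (fun x => ?h (@?f x) ?y ?z) =>
      refine (@lin_comp _ _ _ _ (fun t => h t y z) f (let: And3 p _ _ := Hh in p y z) _)
  | Hh : trilin ?h |- lin (fun x => ?h ?y (@?f x) ?z) =>
      refine (@lin_comp _ _ _ _ (fun t => h y t z) f (let: And3 _ p _ := Hh in p y z) _)
  | Hh : trilin ?h |- lin (fun x => ?h ?y ?z (@?f x)) =>
      refine (@lin_comp _ _ _ _ (h y z) f (let: And3 _ _ p := Hh in p y z) _)
  | Hg : @lin ?C ?U ?V ?g |- lin (fun x => ?g (@?f x)) =>
      refine (@lin_comp C _ U V g f Hg _)
  | |- lin ?f => lazymatch f with (fun _ => _) => fail | _ => change (lin (fun z => f z)) end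
  end.
Ltac slin := by repeat (slin1; cbv beta).

Section Sweedler.
Variables (C : fieldType) (n : nat) (H : wha C n).
Hypothesis HH : is_weak_hopf H.
Notation E := 'rV[C]_n.
Notation mul := (amul H).
Notation one := (wone H).
Notation S := (antip H).
Notation "'sw' h x" := (tsum2 h (comul H x)) (at level 10, h at level 9, x at level 9).

Lemma amulA x y z : mul (mul x y) z = mul x (mul y z).
Proof. by case: HH. Qed.

Lemma amul1l x : mul one x = x.
Proof. by case: HH => _ [/(_ x) []]. Qed.

Lemma amul1r x : mul x one = x.
Proof. by case: HH => _ [/(_ x) []]. Qed.

Lemma tsum3_comul2 (V : lmodType C) (h : E -> E -> E -> V) x :
  tsum3 h (comul2 H x) = sw (fun a b => sw (fun p q => h p q b) a) x.
Proof.
rewrite /comul2 (tsum2_comp _ _ (@lin_tsum3 _ _ _ h)); apply: eq_tsum2 => i j.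
rewrite (tsum2_comp _ _ (@lin_tsum3 _ _ _ h)); apply: eq_tsum2 => p q.
exact: tsum3_t3b.
Qed.

Lemma sw_coassoc (V : lmodType C) (h : E -> E -> E -> V) x :
  sw (fun a b => sw (fun p q => h p q b) a) x = sw (fun a b => sw (fun p q => h a p q) b) x.
Proof.
have [_ [_ [Hc _]]] := HH; rewrite -(tsum3_comul2 h x) Hc.
rewrite /comul2' (tsum2_comp _ _ (@lin_tsum3 _ _ _ h)); apply: eq_tsum2 => i j.
rewrite (tsum2_comp _ _ (@lin_tsum3 _ _ _ h)); apply: eq_tsum2 => p q.
exact: tsum3_t3b.
Qed.

Lemma sw_counitl (V : lmodType C) (g : E -> V) x :
  lin g -> sw (fun a b => eps H a *: g b) x = g x.
Proof.
move=> Hg; have [_ [_ [_ [/(_ x) [Hx _] _]]]] := HH.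
rewrite -{2}Hx (tsum2_comp _ _ Hg); apply: eq_tsum2 => i j; by rewrite linZ.
Qed.

Lemma sw_counitr (V : lmodType C) (g : E -> V) x :
  lin g -> sw (fun a b => eps H b *: g a) x = g x.
Proof.
move=> Hg; have [_ [_ [_ [/(_ x) [_ Hx] _]]]] := HH.
rewrite -{2}Hx (tsum2_comp _ _ Hg); apply: eq_tsum2 => i j; by rewrite linZ.
Qed.

Lemma tsum2_tmul2 (V : lmodType C) (h : E -> E -> V) X Y : bilin h ->
  tsum2 h (tmul2 H X Y) = tsum2 (fun a b => tsum2 (fun c d => h (mul a c) (mul b d)) Y) X.
Proof.
move=> Hh; rewrite /tmul2 (tsum2_comp _ _ (@lin_tsum2 _ _ _ h)).
apply: eq_tsum2 => i j; rewrite (tsum2_comp _ _ (@lin_tsum2 _ _ _ h)).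
by apply: eq_tsum2 => p q; rewrite tsum2_t2.
Qed.

Lemma sw_mul (V : lmodType C) (h : E -> E -> V) x y : bilin h ->
  sw h (mul x y) = sw (fun a b => sw (fun c d => h (mul a c) (mul b d)) y) x.
Proof.
by move=> Hh; have [_ [_ [_ [_ [-> _]]]]] := HH; rewrite tsum2_tmul2.
Qed.

Lemma sw_onel (V : lmodType C) (h : E -> E -> V) x : bilin h ->
  sw h x = sw (fun a b => sw (fun c d => h (mul a c) (mul b d)) x) one.
Proof. by move=> Hh; rewrite -sw_mul // amul1l. Qed.

Lemma sw_oner (V : lmodType C) (h : E -> E -> V) x : bilin h ->
  sw h x = sw (fun a b => sw (fun c d => h (mul a c) (mul b d)) one) x.
Proof. by move=> Hh; rewrite -sw_mul // amul1r. Qed.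

Lemma tsum3_tmul3 (V : lmodType C) (h : E -> E -> E -> V) T U : trilin h ->
  tsum3 h (tmul3 H T U) = tsum3 (fun a b c => tsum3 (fun a' b' c' =>
     h (mul a a') (mul b b') (mul c c')) U) T.
Proof.
move=> Hh; rewrite /tmul3 (tsum3_comp _ _ (@lin_tsum3 _ _ _ h)).
apply: eq_bigr => p _; apply: eq_bigr => q _; apply: eq_bigr => r _; congr (_ *: _).
rewrite (tsum3_comp _ _ (@lin_tsum3 _ _ _ h)).
apply: eq_bigr => p' _; apply: eq_bigr => q' _; apply: eq_bigr => r' _; congr (_ *: _).
by rewrite tsum3_t3.
Qed.

Lemma lin_tsum3h (U V : lmodType C) (h : U -> E -> E -> E -> V) X :
  (forall a b c, lin (fun x => h x a b c)) -> lin (fun x => tsum3 (h x) X).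
Proof. by move=> Hh; do 3! [apply: lin_bigsum => ?]; apply: lin_scaler. Qed.

Lemma tsum3_tmul3_1l (V : lmodType C) (h : E -> E -> E -> V) X Y : trilin h ->
  tsum3 h (tmul3 H (tsum2 (fun a b => t3 one a b) X) (tsum2 (fun a b => t3 a b one) Y))
  = tsum2 (fun a b => tsum2 (fun c d => h (mul one c) (mul a d) (mul b one)) Y) X.
Proof.
move=> Hh; rewrite tsum3_tmul3 // (tsum2_comp _ _ (@lin_tsum3 _ _ _ _)).
apply: eq_tsum2 => i j; rewrite tsum3_t3.
  rewrite (tsum2_comp _ _ (@lin_tsum3 _ _ _ _)).
  by apply: eq_tsum2 => p q; rewrite tsum3_t3 //; slin.
by split=> ? ?; apply: lin_tsum3h => ? ? ?; slin.
Qed.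

Lemma tsum3_tmul3_1r (V : lmodType C) (h : E -> E -> E -> V) X Y : trilin h ->
  tsum3 h (tmul3 H (tsum2 (fun a b => t3 a b one) X) (tsum2 (fun a b => t3 one a b) Y))
  = tsum2 (fun a b => tsum2 (fun c d => h (mul a one) (mul b c) (mul one d)) Y) X.
Proof.
move=> Hh; rewrite tsum3_tmul3 // (tsum2_comp _ _ (@lin_tsum3 _ _ _ _)).
apply: eq_tsum2 => i j; rewrite tsum3_t3.
  rewrite (tsum2_comp _ _ (@lin_tsum3 _ _ _ _)).
  by apply: eq_tsum2 => p q; rewrite tsum3_t3 //; slin.
by split=> ? ?; apply: lin_tsum3h => ? ? ?; slin.
Qed.

(** The axioms for Delta^2(1) as merging rules: two copies of Delta(1) whose adjacent legs are
    multiplied, here in one order and in [sw_one2'] in the other, fuse into Delta^2(1). *)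
Lemma sw_one2 (V : lmodType C) (h : E -> E -> E -> V) : trilin h ->
  sw (fun a b => sw (fun p q => h a p q) b) one
  = sw (fun a b => sw (fun c d => h a (mul b c) d) one) one.
Proof.
move=> Hh; rewrite -sw_coassoc -(tsum3_comul2 h).
have [_ [_ [_ [_ [_ [[_ ->] _]]]]]] := HH.
rewrite tsum3_tmul3_1r //; apply: eq_tsum2 => i j; apply: eq_tsum2 => p q.
by rewrite amul1l amul1r.
Qed.

Lemma sw_one2' (V : lmodType C) (h : E -> E -> E -> V) : trilin h ->
  sw (fun a b => sw (fun p q => h a p q) b) one
  = sw (fun a b => sw (fun c d => h a (mul c b) d) one) one.
Proof.
move=> Hh; rewrite -sw_coassoc -(tsum3_comul2 h).
have [_ [_ [_ [_ [_ [[-> _] _]]]]]] := HH.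
rewrite tsum3_tmul3_1l // exchange_tsum2; apply: eq_tsum2 => i j; apply: eq_tsum2 => p q.
by rewrite amul1l amul1r.
Qed.

Lemma eps_mul3 x y z : eps H (mul x (mul y z))
  = tsumC (fun a b => (eps H (mul x a) * eps H (mul b z) : C)) (comul H y).
Proof.
by have [_ [_ [_ [_ [_ [_ [/(_ x y z) [Hx _] _]]]]]]] := HH; rewrite -amulA Hx.
Qed.

Lemma eps_mul3' x y z : eps H (mul x (mul y z))
  = tsumC (fun a b => (eps H (mul x b) * eps H (mul a z) : C)) (comul H y).
Proof.
by have [_ [_ [_ [_ [_ [_ [/(_ x y z) [_ Hx] _]]]]]]] := HH; rewrite -amulA Hx.
Qed.

(** The target and source counital maps. The antipode axioms identify them with expressions in the
    counit and Delta(1); both forms are used. *)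
Definition eps_t x := sw (fun a b => mul a (S b)) x.
Definition eps_s x := sw (fun a b => mul (S a) b) x.

Lemma eps_tE x : eps_t x = sw (fun a b => eps H (mul a x) *: b) one.
Proof. by have [_ [_ [_ [_ [_ [_ [_ /(_ x) [_ []]]]]]]]] := HH. Qed.

Lemma eps_sE x : eps_s x = sw (fun a b => eps H (mul x b) *: a) one.
Proof. by have [_ [_ [_ [_ [_ [_ [_ /(_ x) []]]]]]]] := HH. Qed.

Lemma lin_eps_t : lin eps_t.
Proof. by rewrite /eps_t; slin. Qed.

Lemma lin_eps_s : lin eps_s.
Proof. by rewrite /eps_s; slin. Qed.

Lemma eps_t_one : eps_t one = one.
Proof.
rewrite eps_tE -[RHS](sw_counitl (g := fun x => x)) //.
by apply: eq_tsum2 => i j; rewrite amul1r.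
Qed.

Lemma eps_s_one : eps_s one = one.
Proof.
rewrite eps_sE -[RHS](sw_counitr (g := fun x => x)) //.
by apply: eq_tsum2 => i j; rewrite amul1l.
Qed.

End Sweedler.

(** * The dual weak Hopf algebra *)

(** Packaged as a [wha], so that one Sweedler calculus serves both algebras. Rows of [wS] are images
    of basis vectors, hence the transpose. *)
Definition dual (C : fieldType) n (A : wha C n) : wha C n :=
  WHA (fun i j => dmul A (bvec i) (bvec j)) (weps A) (fun i => dcomul A (bvec i))
      (wone A) (wS A)^T.

Ltac etsum2 := first [apply: eq_tsum2 | apply: eq_tsum2s]; cbv beta.

Section DualStructure.
Variables (C : fieldType) (n : nat) (A : wha C n).
Notation E := 'rV[C]_n.
Notation D := (dual A).

Lemma bilin_dmul : bilin (dmul A).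
Proof.
have evP (c : C) (f f' x : E) : ev (c *: f + f') x = c * ev f x + ev f' x.
  exact: (lin_evl x c f f').
split=> g c f f'; apply/rowP => i; rewrite !mxE /tsum2s.
  rewrite mulr_sumr -big_split /=; apply: eq_bigr => j _.
  rewrite mulr_sumr -big_split /=; apply: eq_bigr => k _.
  by rewrite evP mulrDl mulrDr -mulrA; congr (_ + _); rewrite mulrCA.
rewrite mulr_sumr -big_split /=; apply: eq_bigr => j _.
rewrite mulr_sumr -big_split /=; apply: eq_bigr => k _.
by rewrite evP !mulrDr; congr (_ + _); rewrite [X in _ * X]mulrCA; exact: mulrCA.
Qed.

Lemma amul_dual f g : amul D f g = dmul A f g.
Proof.
have [hl hr] := bilin_dmul.
rewrite (lin_expand f (hl g)); apply: eq_bigr => i _.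
rewrite (lin_expand g (hr _)) scaler_sumr; apply: eq_bigr => j _.
by rewrite scalerA.
Qed.

Lemma comul_dual f : comul D f = dcomul A f.
Proof.
have H : lin (dcomul A).
  by move=> c x y; apply/matrixP => i j; rewrite !mxE (lin_evl (amul A (bvec i) (bvec j)) c x y).
by rewrite (lin_expand f H).
Qed.

Lemma eps_dual f : eps D f = ev f (wone A).
Proof. by []. Qed.

Lemma ev_antip_dual f x : ev (antip D f) x = ev f (antip A x).
Proof.
rewrite /ev /antip /=.
transitivity (\sum_i \sum_j f 0 j * (wS A i j * x 0 i)).
  by apply: eq_bigr => i _; rewrite mxE mulr_suml; apply: eq_bigr => j _; rewrite mxE mulrA.
rewrite exchange_big; apply: eq_bigr => i _ /=; rewrite mxE mulr_sumr.
by apply: eq_bigr => j _; rewrite [wS A j i * _]mulrC.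
Qed.

Lemma antip_dual f : antip D f = dS A f.
Proof. by apply/rowP => i; rewrite [RHS]mxE -ev_antip_dual ev_bvec. Qed.

Lemma ev_amul_dual f g x :
  ev (amul D f g) x = tsumC (fun a b => (ev f a * ev g b : C)) (comul A x).
Proof.
rewrite amul_dual; move: x.
apply: (@eq_lin _ _ C^o (fun x => (ev (dmul A f g) x : C))
  (fun x => tsumC (fun a b => (ev f a * ev g b : C)) (comul A x))); [slin|slin|move=> i].
by rewrite ev_bvec mxE.
Qed.

(** With [ev_amul_dual] this is the dictionary between the two algebras: each coproduct is the
    transpose of the other product. *)
Lemma tsum2_comul_dual f x y :
  tsumC (fun a b => (ev a x * ev b y : C)) (comul D f) = ev f (amul A x y).
Proof.
move: x; apply: (@eq_lin _ _ C^o); try slin; move=> i.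
move: y; apply: (@eq_lin _ _ C^o); try slin; move=> j.
rewrite comul_dual /tsum2 (bigD1 i) //= (bigD1 j) //= !mxE !ev_bvec !bvecE !eqxx /= mulr1.
rewrite [_ *: _]mulr1 big1 ?addr0 => [|k kj]; last first.
  by rewrite !ev_bvec !bvecE (negbTE kj) mulr0 scaler0.
rewrite big1 ?addr0 // => k ki; rewrite big1 // => p _.
by rewrite !ev_bvec !bvecE (negbTE ki) mul0r scaler0.
Qed.

Lemma ev_tsum2l (h : E -> E -> E) X x :
  ev (tsum2 h X) x = tsumC (fun a b => (ev (h a b) x : C)) X.
Proof. by rewrite (tsum2_comp _ _ (lin_evl x)). Qed.

Lemma tsum2_scale (h : E -> E -> C) (c : C) X :
  c * tsumC h X = tsumC (fun a b => (c * h a b : C)) X.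
Proof.
apply: (@tsum2_comp C n C^o C^o (fun z : C => c * z : C)).
by apply: lin_mulsr; exact: lin_id.
Qed.

Lemma tsum2_scaler (h : E -> E -> C) (c : C) X :
  tsumC h X * c = tsumC (fun a b => (h a b * c : C)) X.
Proof.
apply: (@tsum2_comp C n C^o C^o (fun z : C => z * c : C)).
by apply: lin_mulsl; exact: lin_id.
Qed.

Lemma tsum2_prod (h h' : E -> E -> C) X Y :
  tsumC h X * tsumC h' Y = tsumC (fun a b => tsumC (fun c d => (h a b * h' c d : C)) Y) X.
Proof.
by rewrite tsum2_scaler; etsum2; move=> i j; rewrite tsum2_scale.
Qed.

Lemma tsum2_3E (h : E -> E -> 'M[C]_(n, n * n)) X p k :
  tsum2 h X p k = tsumC (fun a b => (h a b p k : C)) X.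
Proof.
by rewrite (tsum2_comp (M := C^o) (f := fun Y : 'M[C]_(n, n * n) => (Y p k : C))) // => c x y; rewrite !mxE.
Qed.

End DualStructure.

Section DualWeakHopf.
Variables (C : fieldType) (n : nat) (A : wha C n).
Hypothesis HA : is_weak_hopf A.
Notation E := 'rV[C]_n.
Notation D := (dual A).

Lemma ev_ext (f g : E) : (forall x, ev f x = ev g x) -> f = g.
Proof. by move=> H; apply: ev_inj => x; rewrite evC H evC. Qed.

Lemma dual_mulA f g h : amul D (amul D f g) h = amul D f (amul D g h).
Proof.
apply: ev_ext => x; rewrite !ev_amul_dual.
transitivity (tsumC (fun a b => tsumC (fun p q => (ev f p * ev g q * ev h b : C)) (comul A a)) (comul A x)).
  by etsum2; move=> i j; rewrite ev_amul_dual tsum2_scaler.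
rewrite (sw_coassoc (V := C^o) HA (fun p q b => (ev f p * ev g q * ev h b : C))).
etsum2; move=> i j; rewrite ev_amul_dual tsum2_scale.
by etsum2; move=> p q; rewrite mulrA.
Qed.

Lemma ev_weps x : ev (weps A) x = eps A x.
Proof. by rewrite evC. Qed.

Lemma dual_unit f : amul D (weps A) f = f /\ amul D f (weps A) = f.
Proof.
split; apply: ev_ext => x; rewrite ev_amul_dual.
  rewrite -(sw_counitl HA x (lin_ev f)).
  by etsum2; move=> i j; rewrite ev_weps.
rewrite -(sw_counitr HA x (lin_ev f)).
by etsum2; move=> i j; rewrite ev_weps mulrC.
Qed.

Lemma comul2_dualE f p q r :
  comul2 D f p (mxvec_index q r) = ev f (amul A (amul A (bvec p) (bvec q)) (bvec r)).
Proof.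
rewrite /comul2 tsum2_3E -tsum2_comul_dual; etsum2; move=> i j.
rewrite tsum2_3E -(tsum2_comul_dual A (bvec i)) tsum2_scaler; etsum2; move=> s t.
by rewrite t3E !ev_bvec.
Qed.

Lemma comul2'_dualE f p q r :
  comul2' D f p (mxvec_index q r) = ev f (amul A (bvec p) (amul A (bvec q) (bvec r))).
Proof.
rewrite /comul2' tsum2_3E -tsum2_comul_dual; etsum2; move=> i j.
rewrite tsum2_3E -tsum2_comul_dual tsum2_scale; etsum2; move=> s t.
by rewrite t3E !ev_bvec mulrA.
Qed.

Lemma dual_coassoc f : comul2 D f = comul2' D f.
Proof. by apply: mx3P => p q r; rewrite comul2_dualE comul2'_dualE amulA. Qed.

Lemma dual_counit f :
  tsum2 (fun a b => eps D a *: b) (comul D f) = f /\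
  tsum2 (fun a b => eps D b *: a) (comul D f) = f.
Proof.
split; apply: ev_ext => x; rewrite ev_tsum2l.
  rewrite -[in RHS](amul1l HA x) -tsum2_comul_dual; etsum2; move=> i j.
  by rewrite (linZ (lin_evl x)) eps_dual.
rewrite -[in RHS](amul1r HA x) -tsum2_comul_dual; etsum2; move=> i j.
by rewrite (linZ (lin_evl x)) eps_dual mulrC.
Qed.

Lemma tmul2_dualE X Y i j : tmul2 D X Y i j
  = tsumC (fun p q => tsumC (fun r s =>
      (tsumC (fun a b => (ev a p * ev b r : C)) X * tsumC (fun c d => (ev c q * ev d s : C)) Y : C))
        (comul A (bvec j))) (comul A (bvec i)).
Proof.
rewrite /tmul2 tsum2E; symmetry.
transitivity (tsumC (fun p q => tsumC (fun r s =>
   tsumC (fun a b => tsumC (fun c d => (ev a p * ev b r * (ev c q * ev d s) : C))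
     Y) X) (comul A (bvec j))) (comul A (bvec i))).
  by etsum2; move=> p q; etsum2; move=> r s; rewrite tsum2_prod.
transitivity (tsumC (fun a b => tsumC (fun p q => tsumC (fun r s =>
   tsumC (fun c d => (ev a p * ev b r * (ev c q * ev d s) : C))
     Y) (comul A (bvec j))) (comul A (bvec i))) X).
  rewrite -[RHS]exchange_tsum2; etsum2; move=> p q.
  by rewrite exchange_tsum2.
etsum2; move=> a b; rewrite tsum2E.
transitivity (tsumC (fun c d => tsumC (fun p q => tsumC (fun r s =>
   (ev (bvec a) p * ev (bvec b) r * (ev c q * ev d s) : C))
     (comul A (bvec j))) (comul A (bvec i))) Y).
  rewrite -[RHS]exchange_tsum2; etsum2; move=> p q.
  by rewrite exchange_tsum2.
etsum2; move=> c d; rewrite t2E -!(ev_bvec (amul D _ _)) !ev_amul_dual tsum2_prod.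
by etsum2; move=> p q; etsum2; move=> r s; rewrite mulrACA.
Qed.

Lemma dtmul_dual X Y : dtmul A X Y = tmul2 D X Y.
Proof.
have ev2E (Z : 'M[C]_n) p q :
    ev2 Z (bvec p) (bvec q) = tsumC (fun a b => (ev a (bvec p) * ev b (bvec q) : C)) Z.
  have -> : ev2 Z (bvec p) (bvec q) = Z p q.
    by rewrite /ev2 -rowE trmx_delta -colE !mxE.
  rewrite -{1}[Z]tsum2_t2id tsum2E; etsum2; move=> a b.
  by rewrite t2E !ev_bvec.
apply/matrixP => i j; rewrite tmul2_dualE mxE.
by etsum2; move=> p q; etsum2; move=> r s; rewrite !ev2E.
Qed.

Lemma dual_comulM f g : comul D (amul D f g) = tmul2 D (comul D f) (comul D g).
Proof.
apply/matrixP => i j; rewrite tmul2_dualE {1}comul_dual mxE ev_amul_dual.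
rewrite (sw_mul (V := C^o) HA (h := fun a b => (ev f a * ev g b : C))); last by slin.
by etsum2; move=> p q; etsum2; move=> r s; rewrite !tsum2_comul_dual.
Qed.

(** On basis triples these are the two axioms for the counit of a triple product in [A]; [dual_eps3]
    goes the opposite way. *)
Lemma dual_comul2_one :
  comul2 D (weps A)
  = tmul3 D (tsum2 (fun a b => t3 (weps A) a b) (comul D (weps A)))
            (tsum2 (fun a b => t3 a b (weps A)) (comul D (weps A)))
  /\ comul2 D (weps A)
  = tmul3 D (tsum2 (fun a b => t3 a b (weps A)) (comul D (weps A)))
            (tsum2 (fun a b => t3 (weps A) a b) (comul D (weps A))).
Proof.
(* A coordinate of a threefold tensor written as a Sweedler sum of a trilinear form, to which the
   expansions of [tmul3] apply. *)
pose cf p q r (x y z : E) : C := x 0 p * y 0 q * z 0 r.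
have Hcf p q r : @trilin C n C^o (cf p q r) by rewrite /cf; slin.
have cfE p q r (T : 'M[C]_(n, n * n)) : T p (mxvec_index q r) = @tsum3 C n C^o (cf p q r) T.
  rewrite /tsum3 (bigD1 p) //= (bigD1 q) //= (bigD1 r) //= /cf !bvecE !eqxx !mulr1.
  rewrite [_ *: _]mulr1 big1 ?addr0 => [|s sk]; last by rewrite !bvecE (negbTE sk) mulr0 scaler0.
  rewrite big1 ?addr0 => [|s sk]; last first.
    by rewrite big1 // => t _; rewrite !bvecE (negbTE sk) mulr0 mul0r scaler0.
  rewrite big1 ?addr0 // => s sk.
  by rewrite big1 // => u _; rewrite big1 // => t _; rewrite !bvecE (negbTE sk) !mul0r scaler0.
have col1 (a b c d : E) p q r : cf p q r c (amul D a d) b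
    = tsumC (fun s t => (ev c (bvec p) * (ev a s * ev d t) * ev b (bvec r) : C)) (comul A (bvec q)).
  rewrite /cf -(ev_bvec (amul D a d)) ev_amul_dual tsum2_scale tsum2_scaler.
  by etsum2; move=> i j; rewrite !ev_bvec.
split; apply: mx3P => p q r; rewrite comul2_dualE cfE amulA //.
  rewrite (@tsum3_tmul3_1l _ _ D C^o (cf p q r)) // ev_weps eps_mul3' //.
  transitivity (tsumC (fun a b => tsumC (fun c d => tsumC (fun s t =>
     (ev c (bvec p) * (ev a s * ev d t) * ev b (bvec r) : C)) (comul A (bvec q)))
      (comul D (weps A))) (comul D (weps A))); last first.
    etsum2; move=> i j; etsum2; move=> i' j'; rewrite -col1.
    by rewrite (proj1 (dual_unit _)) (proj2 (dual_unit _)).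
  rewrite exchange_tsum2.
  transitivity (tsumC (fun c d => tsumC (fun s t => tsumC (fun a b =>
     (ev c (bvec p) * (ev a s * ev d t) * ev b (bvec r) : C)) 
      (comul D (weps A))) (comul A (bvec q))) (comul D (weps A))); last first.
    by etsum2; move=> i j; rewrite exchange_tsum2.
  rewrite exchange_tsum2; etsum2; move=> s t.
  rewrite -!ev_weps -!tsum2_comul_dual tsum2_prod; etsum2; move=> i j; etsum2; move=> i' j'.
  by rewrite -!mulrA; congr (_ * _); rewrite mulrCA.
rewrite (@tsum3_tmul3_1r _ _ D C^o (cf p q r)) // ev_weps eps_mul3 //.
transitivity (tsumC (fun a b => tsumC (fun c d => tsumC (fun s t =>
   (ev a (bvec p) * (ev b s * ev c t) * ev d (bvec r) : C)) (comul A (bvec q)))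
    (comul D (weps A))) (comul D (weps A))); last first.
  etsum2; move=> i j; etsum2; move=> i' j'; rewrite -col1.
  by rewrite (proj1 (dual_unit _)) (proj2 (dual_unit _)).
transitivity (tsumC (fun a b => tsumC (fun s t => tsumC (fun c d =>
   (ev a (bvec p) * (ev b s * ev c t) * ev d (bvec r) : C)) 
    (comul D (weps A))) (comul A (bvec q))) (comul D (weps A))); last first.
  by etsum2; move=> i j; rewrite exchange_tsum2.
rewrite exchange_tsum2; etsum2; move=> s t.
rewrite -!ev_weps -!tsum2_comul_dual tsum2_prod; etsum2; move=> i j; etsum2; move=> i' j'.
by rewrite -!mulrA.
Qed.

(** The dual counit is evaluation at 1, so both identities are the merging rules for Delta^2(1) in
    [A] read through three functionals. *)
Lemma dual_eps3 f g h :
  eps D (amul D (amul D f g) h)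
    = tsum2s (fun a b => eps D (amul D f a) * eps D (amul D b h)) (comul D g)
  /\ eps D (amul D (amul D f g) h)
    = tsum2s (fun a b => eps D (amul D f b) * eps D (amul D a h)) (comul D g).
Proof.
have -> : eps D (amul D (amul D f g) h) = tsumC (fun a b => tsumC (fun p q =>
    (ev f a * ev g p * ev h q : C)) (comul A b)) (comul A (wone A)).
  rewrite eps_dual dual_mulA ev_amul_dual; etsum2; move=> i j.
  by rewrite ev_amul_dual tsum2_scale; etsum2; move=> p q; rewrite mulrA.
have epsM u w : eps D (amul D u w) = tsumC (fun a b => (ev u a * ev w b : C)) (comul A (wone A)).
  by rewrite eps_dual ev_amul_dual.
split.
  rewrite (sw_one2 (V := C^o) HA (h := fun a p q => (ev f a * ev g p * ev h q : C))); last by slin.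
  transitivity (tsumC (fun a b => tsumC (fun c d => tsumC (fun i j =>
     (ev f a * (ev i b * ev j c) * ev h d : C)) (comul D g)) (comul A (wone A))) (comul A (wone A))).
    etsum2; move=> i j; etsum2; move=> p q.
    by rewrite -tsum2_comul_dual tsum2_scale tsum2_scaler.
  transitivity (tsumC (fun i j => tsumC (fun a b => tsumC (fun c d =>
     (ev f a * (ev i b * ev j c) * ev h d : C)) (comul A (wone A))) (comul A (wone A))) (comul D g)).
    rewrite -[RHS]exchange_tsum2; etsum2; move=> i j.
    by rewrite exchange_tsum2.
  etsum2; move=> i j; rewrite !epsM tsum2_prod; etsum2; move=> p q; etsum2; move=> s t.
  by rewrite -!mulrA.
rewrite (sw_one2' (V := C^o) HA (h := fun a p q => (ev f a * ev g p * ev h q : C))); last by slin.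
transitivity (tsumC (fun a b => tsumC (fun c d => tsumC (fun i j =>
   (ev f a * (ev i c * ev j b) * ev h d : C)) (comul D g)) (comul A (wone A))) (comul A (wone A))).
  etsum2; move=> i j; etsum2; move=> p q.
  by rewrite -tsum2_comul_dual tsum2_scale tsum2_scaler.
transitivity (tsumC (fun i j => tsumC (fun a b => tsumC (fun c d =>
   (ev f a * (ev i c * ev j b) * ev h d : C)) (comul A (wone A))) (comul A (wone A))) (comul D g)).
  rewrite -[RHS]exchange_tsum2; etsum2; move=> i j.
  by rewrite exchange_tsum2.
etsum2; move=> i j; rewrite !epsM tsum2_prod; etsum2; move=> p q; etsum2; move=> s t.
by rewrite -!mulrA; congr (_ * _); rewrite mulrCA.
Qed.

Lemma ev_tsum2r (f : E) (h : E -> E -> E) X :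
  ev f (tsum2 h X) = tsumC (fun a b => (ev f (h a b) : C)) X.
Proof. exact: (tsum2_comp _ _ (lin_ev f)). Qed.

(** The counital maps of the dual are the transposes of [eps_s] and [eps_t] of [A], and the third
    axiom is transposed likewise. *)
Lemma dual_antipode f :
  tsum2 (fun a b => amul D (antip D a) b) (comul D f)
    = tsum2 (fun a b => eps D (amul D f b) *: a) (comul D (weps A)) /\
  tsum2 (fun a b => amul D a (antip D b)) (comul D f)
    = tsum2 (fun a b => eps D (amul D a f) *: b) (comul D (weps A)) /\
  tsum3 (fun a b c => amul D (amul D (antip D a) b) (antip D c)) (comul2 D f) = antip D f.
Proof.
split; [|split]; apply: ev_ext => x.
- rewrite !ev_tsum2l.
  transitivity (ev f (eps_s A x)).
    rewrite /eps_s ev_tsum2r.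
    transitivity (tsumC (fun a b => tsumC (fun p q => (ev p (antip A a) * ev q b : C)) (comul D f)) (comul A x)).
      rewrite exchange_tsum2; etsum2; move=> i j; rewrite ev_amul_dual; etsum2; move=> p q.
      by rewrite ev_antip_dual.
    by etsum2; move=> i j; rewrite tsum2_comul_dual.
  rewrite eps_sE // ev_tsum2r.
  transitivity (tsumC (fun a b => tsumC (fun p q => (ev f a * (ev p x * ev q b) : C)) (comul D (weps A))) (comul A (wone A))).
    etsum2; move=> i j; rewrite -tsum2_scale tsum2_comul_dual ev_weps.
    by rewrite (linZ (lin_ev f)) mulrC.
  rewrite exchange_tsum2; etsum2; move=> p q; rewrite (linZ (lin_evl x)) eps_dual ev_amul_dual.
  rewrite [RHS]tsum2_scaler; etsum2; move=> i j.
  by rewrite -mulrA; congr (_ * _); rewrite mulrC.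
- rewrite !ev_tsum2l.
  transitivity (ev f (eps_t A x)).
    rewrite /eps_t ev_tsum2r.
    transitivity (tsumC (fun a b => tsumC (fun p q => (ev p a * ev q (antip A b) : C)) (comul D f)) (comul A x)).
      rewrite exchange_tsum2; etsum2; move=> i j; rewrite ev_amul_dual; etsum2; move=> p q.
      by rewrite ev_antip_dual.
    by etsum2; move=> i j; rewrite tsum2_comul_dual.
  rewrite eps_tE // ev_tsum2r.
  transitivity (tsumC (fun a b => tsumC (fun p q => (ev f b * (ev p a * ev q x) : C)) (comul D (weps A))) (comul A (wone A))).
    etsum2; move=> i j; rewrite -tsum2_scale tsum2_comul_dual ev_weps.
    by rewrite (linZ (lin_ev f)) mulrC.
  rewrite exchange_tsum2; etsum2; move=> p q; rewrite (linZ (lin_evl x)) eps_dual ev_amul_dual.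
  rewrite [RHS]tsum2_scaler; etsum2; move=> i j.
  by rewrite mulrA; congr (_ * _); rewrite mulrC.
rewrite ev_antip_dual; have [_ [_ [_ [_ [_ [_ [_ /(_ x) [_ [_ <-]]]]]]]]] := HA.
rewrite !tsum3_comul2 ev_tsum2r ev_tsum2l.
transitivity (tsumC (fun a b => tsumC (fun p q => tsumC (fun i j => tsumC (fun s t =>
   (ev s (antip A p) * ev t q * ev j (antip A b) : C)) (comul D i)) (comul D f)) (comul A a)) (comul A x)); last first.
  etsum2; move=> a b; rewrite ev_tsum2r; etsum2; move=> p q.
  rewrite -tsum2_comul_dual; etsum2; move=> i j.
  by rewrite -tsum2_comul_dual tsum2_scaler.
transitivity (tsumC (fun i j => tsumC (fun s t => tsumC (fun a b => tsumC (fun p q =>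
   (ev s (antip A p) * ev t q * ev j (antip A b) : C)) (comul A a)) (comul A x)) (comul D i)) (comul D f)).
  etsum2; move=> i j; rewrite ev_tsum2l; etsum2; move=> s t.
  rewrite ev_amul_dual; etsum2; move=> a b; rewrite ev_amul_dual tsum2_scaler; etsum2; move=> p q.
  by rewrite !ev_antip_dual.
transitivity (tsumC (fun i j => tsumC (fun a b => tsumC (fun p q => tsumC (fun s t =>
   (ev s (antip A p) * ev t q * ev j (antip A b) : C)) (comul D i)) (comul A a)) (comul A x)) (comul D f)).
  etsum2; move=> i j; rewrite exchange_tsum2; etsum2; move=> a b; exact: (@exchange_tsum2 C n C^o).
rewrite exchange_tsum2; etsum2; move=> a b; exact: (@exchange_tsum2 C n C^o).
Qed.

Lemma is_weak_hopf_dual : is_weak_hopf D.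
Proof.
split; first exact: dual_mulA.
split; first exact: dual_unit.
split; first exact: dual_coassoc.
split; first exact: dual_counit.
split; first exact: dual_comulM.
split; first exact: dual_comul2_one.
split; first exact: dual_eps3.
exact: dual_antipode.
Qed.

End DualWeakHopf.

(** * Counital maps, pivotal elements and traces *)

Section Counital.
Variables (C : fieldType) (n : nat) (H : wha C n).
Hypothesis HH : is_weak_hopf H.
Notation E := 'rV[C]_n.
Notation mul := (amul H).
Notation one := (wone H).
Notation S := (antip H).
Notation et := (eps_t H).
Notation es := (eps_s H).
Notation "'sw' h x" := (tsum2 h (comul H x)) (at level 10, h at level 9, x at level 9).

Let linet : lin et := lin_eps_t H.
Let lines : lin es := lin_eps_s H.

Variables (V : lmodType C) (h : E -> E -> V).
Hypothesis hB : bilin h.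

(** Write x as 1x and expand [et] through a second Delta(1). The two copies merge into Delta^2(1),
    and the counit absorbs the middle leg. *)
Lemma sw_eps_t_r x : sw (fun a b => h a (et b)) x = sw (fun a b => h (mul a x) b) one.
Proof.
rewrite (sw_onel HH (h := fun a b => h a (et b))); last by slin.
transitivity (sw (fun a b => sw (fun p q =>
    sw (fun c d => eps H (mul (mul p b) d) *: h (mul a c) q) x) one) one).
  etsum2; move=> a b; rewrite exchange_tsum2; etsum2; move=> c d.
  rewrite (eps_tE HH) (tsum2_comp _ _ (proj2 hB _)); etsum2; move=> p q.
  by rewrite (amulA HH) linZ //; exact: (proj2 hB).
rewrite -(sw_one2' HH (h := fun a m q => sw (fun c d => eps H (mul m d) *: h (mul a c) q) x)); last by slin.
rewrite -(sw_coassoc HH (fun a m q => sw (fun c d => eps H (mul m d) *: h (mul a c) q) x)).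
etsum2; move=> u q.
rewrite -(sw_counitr HH (g := fun z => h z (bvec q))); last by slin.
by rewrite (sw_mul HH (h := fun c d => eps H d *: h c (bvec q))) //; slin.
Qed.

(** Splitting the counit of a triple product gives eps_t(yz) = eps_t(y_1) eps(y_2 z). Applied to x =
    1x, the counit then absorbs the first leg of x. *)
Lemma sw_one_eps_t_r x :
  sw (fun a b => h (et a) b) x = sw (fun a b => h (et a) (mul b x)) one.
Proof.
rewrite (sw_onel HH (h := fun a b => h (et a) b)); last by slin.
transitivity (sw (fun a b => sw (fun s t =>
    sw (fun c d => eps H (mul t c) *: h (et s) (mul b d)) x) a) one).
  etsum2; move=> a b; rewrite exchange_tsum2; etsum2; move=> c d.
  rewrite (eps_tE HH) (tsum2_comp (f := fun z => h z (mul (bvec b) (bvec d)))); last by slin.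
  transitivity (sw (fun p q => sw (fun s t => (eps H (mul p s) * eps H (mul t (bvec c)))
      *: h q (mul (bvec b) (bvec d))) (bvec a)) one).
    etsum2; move=> p q; rewrite (linZ (f := fun z => h z (mul (bvec b) (bvec d)))); last by slin.
    rewrite (eps_mul3 HH) (tsum2_comp (f := fun z : C^o => z *: h (bvec q) (mul (bvec b) (bvec d)))) //.
    by move=> *; rewrite scalerDl scalerA.
  rewrite exchange_tsum2; etsum2; move=> s t.
  rewrite (eps_tE HH) (tsum2_comp (f := fun z => eps H (mul (bvec t) (bvec c)) *: h z (mul (bvec b) (bvec d)))); last by slin.
  etsum2; move=> p q; rewrite (linZ (f := fun z => h z (mul (bvec b) (bvec d)))); last by slin.
  by rewrite scalerA mulrC.
rewrite (sw_coassoc HH (fun s t b => sw (fun c d => eps H (mul t c) *: h (et s) (mul b d)) x)).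
etsum2; move=> s u.
rewrite -(sw_counitl HH (g := fun z => h (et (bvec s)) z)); last by slin.
by rewrite (sw_mul HH (h := fun c d => eps H c *: h (et (bvec s)) d)) //; slin.
Qed.

Lemma sw_one_eps_s_l x :
  sw (fun a b => h a (es b)) x = sw (fun a b => h (mul x a) (es b)) one.
Proof.
rewrite (sw_oner HH (h := fun a b => h a (es b))); last by slin.
rewrite exchange_tsum2.
transitivity (sw (fun c d => sw (fun s t =>
    sw (fun a b => eps H (mul b s) *: h (mul a c) (es t)) x) d) one).
  etsum2; move=> c d; rewrite exchange_tsum2; etsum2; move=> a b.
  rewrite (eps_sE HH) (tsum2_comp (f := fun z => h (mul (bvec a) (bvec c)) z)); last by slin.
  transitivity (sw (fun p q => sw (fun s t => (eps H (mul (bvec b) s) * eps H (mul t q))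
      *: h (mul (bvec a) (bvec c)) p) (bvec d)) one).
    etsum2; move=> p q; rewrite (linZ (f := fun z => h (mul (bvec a) (bvec c)) z)); last by slin.
    rewrite (amulA HH) (eps_mul3 HH) (tsum2_comp (f := fun z : C^o => z *: h (mul (bvec a) (bvec c)) (bvec p))) //.
    by move=> *; rewrite scalerDl scalerA.
  rewrite exchange_tsum2; etsum2; move=> s t.
  rewrite (eps_sE HH) (tsum2_comp (f := fun z => eps H (mul (bvec b) (bvec s)) *: h (mul (bvec a) (bvec c)) z)); last by slin.
  etsum2; move=> p q; rewrite (linZ (f := fun z => h (mul (bvec a) (bvec c)) z)); last by slin.
  by rewrite scalerA.
rewrite -(sw_coassoc HH (fun c s t => sw (fun a b => eps H (mul b s) *: h (mul a c) (es t)) x)).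
etsum2; move=> u t.
rewrite -(sw_counitr HH (g := fun z => h z (es (bvec t)))); last by slin.
rewrite (sw_mul HH (h := fun c d => eps H d *: h c (es (bvec t)))) //; last by slin.
by rewrite exchange_tsum2.
Qed.

(** Supplied for the dual by [dual_antipM]. *)
Hypothesis antipM : forall x y, S (mul x y) = mul (S y) (S x).

Lemma sw_eps_t_l x : sw (fun a b => h (et a) b) x = sw (fun a b => h (S a) (mul b x)) one.
Proof.
rewrite sw_one_eps_t_r.
transitivity (sw (fun a b => sw (fun p q => h (mul p (S q)) (mul b x)) a) one).
  etsum2; move=> a b.
  by rewrite /eps_t (tsum2_comp (f := fun z => h z (mul (bvec b) x))) //; slin.
rewrite (sw_coassoc HH (fun p q b => h (mul p (S q)) (mul b x))).
rewrite (sw_one2' HH (h := fun p q b => h (mul p (S q)) (mul b x))); last by slin.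
rewrite exchange_tsum2; etsum2; move=> c d.
(* Inserting eps_t(1) = 1 creates the second copy of Delta(1) present on the other side: S(c) =
   1_(1) S(c 1_(2)). *)
have E1 : S (bvec c) = mul (et one) (S (bvec c)) by rewrite (eps_t_one HH) (amul1l HH).
rewrite [in RHS]E1 /eps_t.
rewrite (tsum2_comp (f := fun z => h (mul z (S (bvec c))) (mul (bvec d) x))); last by slin.
by etsum2; move=> a b; rewrite antipM !(amulA HH).
Qed.

Lemma sw_eps_s_r x : sw (fun a b => h a (es b)) x = sw (fun a b => h (mul x a) (S b)) one.
Proof.
rewrite sw_one_eps_s_l.
transitivity (sw (fun a b => sw (fun p q => h (mul x a) (mul (S p) q)) b) one).
  etsum2; move=> a b.
  by rewrite /eps_s (tsum2_comp (f := fun z => h (mul x (bvec a)) z)) //; slin.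
rewrite (sw_one2' HH (h := fun a p q => h (mul x a) (mul (S p) q))); last by slin.
etsum2; move=> a b.
have E1 : S (bvec b) = mul (S (bvec b)) (es one) by rewrite (eps_s_one HH) (amul1r HH).
rewrite [in RHS]E1 /eps_s.
rewrite (tsum2_comp (f := fun z => h (mul x (bvec a)) (mul (S (bvec b)) z))); last by slin.
by etsum2; move=> c d; rewrite antipM !(amulA HH).
Qed.

End Counital.

(** * Elements of the source base algebra *)

Section SourceElements.
Variables (C : fieldType) (n : nat) (H : wha C n).
Hypothesis HH : is_weak_hopf H.
Notation E := 'rV[C]_n.
Notation mul := (amul H).
Notation one := (wone H).
Notation "'sw' h x" := (tsum2 h (comul H x)) (at level 10, h at level 9, x at level 9).

Variable phi : E -> C.
Hypothesis phiL : @lin C E C^o phi.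

(** Slices of the second leg of Delta(1), the general form of an element of the source base
    algebra. *)
Definition src : E := sw (fun a b => phi b *: a) one.

Lemma eps_s_src : sw (fun a b => eps H (mul src b) *: a) one = src.
Proof.
transitivity (sw (fun a b => sw (fun c d => eps H (mul c b) *: (phi d *: a)) one) one).
  etsum2; move=> a b; rewrite /src.
  rewrite (tsum2_comp (f := fun z => eps H (mul z (bvec b)) *: bvec a)); last by slin.
  etsum2; move=> c d.
  by rewrite (linZ (f := fun z => eps H (mul z (bvec b)) *: bvec a)) //; [rewrite !scalerA mulrC | slin].
rewrite -(sw_one2' HH (h := fun a m d => eps H m *: (phi d *: a))); last by slin.
etsum2; move=> a b.
by rewrite (sw_counitl HH (g := fun d => phi d *: bvec a)) //; slin.
Qed.

(** Slicing the last leg of Delta^2(1), split into two copies of Delta(1), gives Delta(src) = (1 (x)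
    src) Delta(1); so the first leg never meets [src]. *)
Lemma sw_src_mul (V : lmodType C) (h : E -> E -> V) x : bilin h ->
  sw h (mul src x) = sw (fun a b => h a (mul src b)) x.
Proof.
move=> hB.
have src_sw (g : E -> E -> V) : bilin g -> sw g src = sw (fun a b => g a (mul src b)) one.
  move=> gB.
  transitivity (sw (fun a b => sw (fun p q => phi b *: g p q) a) one).
    rewrite /src (tsum2_comp (f := fun z => sw g z)); last by slin.
    etsum2; move=> a b; rewrite (linZ (f := fun z => sw g z)); last by slin.
    by rewrite (tsum2_comp (f := fun z => phi (bvec b) *: z)) //; slin.
  rewrite (sw_coassoc HH (fun p q b => phi b *: g p q)).
  rewrite (sw_one2' HH (h := fun p q b => phi b *: g p q)); last by slin.
  etsum2; move=> a b; rewrite /src.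
  rewrite (tsum2_comp (f := fun z => g (bvec a) (mul z (bvec b)))); last by slin.
  by etsum2; move=> c d; rewrite (linZ (f := fun z => g (bvec a) (mul z (bvec b)))) //; slin.
rewrite (sw_mul HH _ _ hB) (src_sw (fun a b => sw (fun c d => h (mul a c) (mul b d)) x)); last by slin.
rewrite [RHS](sw_onel HH) //; last by slin.
by etsum2; move=> a b; etsum2; move=> c d; rewrite (amulA HH).
Qed.

End SourceElements.

(** * Pivotal elements and the trace of the squared antipode *)

Section Pivotal.
Variables (C : fieldType) (n : nat) (H : wha C n).
Hypothesis HH : is_weak_hopf H.
Notation E := 'rV[C]_n.
Notation mul := (amul H).
Notation one := (wone H).
Notation S := (antip H).
Notation et := (eps_t H).
Notation es := (eps_s H).
Notation "'sw' h x" := (tsum2 h (comul H x)) (at level 10, h at level 9, x at level 9).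

Hypothesis antipM : forall x y, S (mul x y) = mul (S y) (S x).
Variables k ki : E.
Hypothesis kki : mul k ki = one.
Hypothesis kik : mul ki k = one.
Hypothesis kgl : comul H k = tmul2 H (t2 k k) (comul H one).
Hypothesis kgr : comul H k = tmul2 H (comul H one) (t2 k k).
Hypothesis S2 : forall x, S (S x) = mul (mul k x) ki.

Lemma sw_glikel (V : lmodType C) (h : E -> E -> V) x : bilin h ->
  sw h (mul k x) = sw (fun a b => h (mul k a) (mul k b)) x.
Proof.
move=> hB; rewrite (sw_mul HH _ _ hB) kgl tsum2_tmul2; last by slin.
rewrite tsum2_t2; last by slin.
rewrite [RHS](sw_onel HH); last by slin.
by etsum2; move=> a b; etsum2; move=> c d; rewrite !(amulA HH).
Qed.

Lemma sw_gliker (V : lmodType C) (h : E -> E -> V) x : bilin h ->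
  sw h (mul x k) = sw (fun a b => h (mul a k) (mul b k)) x.
Proof.
move=> hB; rewrite (sw_mul HH _ _ hB) exchange_tsum2 kgr tsum2_tmul2; last by slin.
rewrite [RHS](sw_oner HH); last by slin.
rewrite [RHS]exchange_tsum2; etsum2; move=> a b.
rewrite tsum2_t2; last by slin.
by etsum2; move=> c d; rewrite !(amulA HH).
Qed.

Lemma sw_glikeVl (V : lmodType C) (h : E -> E -> V) x : bilin h ->
  sw h (mul ki x) = sw (fun a b => h (mul ki a) (mul ki b)) x.
Proof.
move=> hB; rewrite -[x in RHS](amul1l HH) -kki (amulA HH) sw_glikel; last by slin.
by etsum2; move=> a b; rewrite -!(amulA HH) kik !(amul1l HH).
Qed.

Lemma sw_glikeVr (V : lmodType C) (h : E -> E -> V) x : bilin h ->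
  sw h (mul x ki) = sw (fun a b => h (mul a ki) (mul b ki)) x.
Proof.
move=> hB; rewrite -[x in RHS](amul1r HH) -kik -(amulA HH) sw_gliker; last by slin.
by etsum2; move=> a b; rewrite !(amulA HH) kki !(amul1r HH).
Qed.

(** Group-likeness gives eps_t(k) = k S(k), and the counit formula for [et] gives eps_t(k) k = k, so
    k S(k) = 1. *)
Lemma antip_glike : S k = ki.
Proof.
have etk : et k = mul k (S k).
  rewrite /eps_t -{1}[k](amul1r HH) sw_glikel; last by slin.
  transitivity (mul (mul k (et one)) (S k)); last by rewrite (eps_t_one HH) (amul1r HH).
  rewrite /eps_t (tsum2_comp (f := fun z => mul (mul k z) (S k))); last by slin.
  by etsum2; move=> a b; rewrite antipM !(amulA HH).
have etkk : mul (et k) k = k.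
  rewrite -[RHS](sw_counitl HH (g := fun z => z)) //.
  rewrite -{3}[k](amul1l HH) sw_gliker; last by slin.
  rewrite (eps_tE HH) (tsum2_comp (f := fun z => mul z k)); last by slin.
  by etsum2; move=> a b; rewrite (linZ (f := fun z => mul z k)) //; slin.
have et1 : et k = one by rewrite -[et k](amul1r HH) -kki -(amulA HH) etkk.
by rewrite -[S k](amul1l HH) -kik (amulA HH) -etk et1 (amul1r HH).
Qed.

Lemma sw_antip2 (V : lmodType C) (h : E -> E -> V) x : bilin h ->
  sw h (S (S x)) = sw (fun a b => h (S (S a)) (S (S b))) x.
Proof.
move=> hB; rewrite S2 sw_glikeVr // sw_glikel; last by slin.
by etsum2; move=> a b; rewrite !S2.
Qed.

Lemma antip2_one : S (S one) = one.
Proof. by rewrite S2 (amul1r HH). Qed.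

(** One way of cutting the trace in [trS2_pull]. On the right x_1 S(x_2) collapses to eps_t, which
    [sw_eps_t_l] trades for a copy of Delta(1); S^2 respects coproducts, so that copy is absorbed by
    Delta(g). *)
Lemma sw_shift_antip2 (V : lmodType C) (h : E -> E -> V) g x : bilin h ->
  sw (fun c d => h c (mul d (S (S x)))) g
  = sw (fun a b => sw (fun c d => h (mul c (S a)) d) (mul g (S (S b)))) x.
Proof.
move=> hB; symmetry.
transitivity (sw (fun a b => sw (fun c d => sw (fun p q =>
   h (mul c (S (mul a (S p)))) (mul d (S (S q)))) b) g) x).
  etsum2; move=> a b; rewrite (sw_mul HH); last by slin.
  etsum2; move=> c d; rewrite sw_antip2; last by slin.
  by etsum2; move=> p q; rewrite (amulA HH) antipM.
rewrite exchange_tsum2.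
transitivity (sw (fun c d => sw (fun p q => h (mul c p) (mul (mul d q) (S (S x)))) one) g); last first.
  by rewrite -(sw_oner HH (h := fun c d => h c (mul d (S (S x))))) //; slin.
etsum2; move=> c d.
rewrite -(sw_coassoc HH (fun a p q => h (mul (bvec c) (S (mul a (S p)))) (mul (bvec d) (S (S q))))).
transitivity (sw (fun u q => h (mul (bvec c) (S (et u))) (mul (bvec d) (S (S q)))) x).
  etsum2; move=> u q; rewrite /eps_t.
  by rewrite (tsum2_comp (f := fun z => h (mul (bvec c) (S z)) (mul (bvec d) (S (S (bvec q)))))) //; slin.
rewrite (sw_eps_t_l HH (h := fun u q => h (mul (bvec c) (S u)) (mul (bvec d) (S (S q))))) //; last by slin.
rewrite -[one in RHS]antip2_one sw_antip2; last by slin.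
by etsum2; move=> a b; rewrite !antipM (amulA HH).
Qed.

(** The other way of cutting the trace, again by collapsing y_1 S(y_2) to eps_t. *)
Lemma sw_shift_antip (V : lmodType C) (h : E -> E -> V) f y : bilin h ->
  sw (fun a b => h (S a) (mul b y)) f
  = sw (fun c d => sw (fun a b => h (mul c (S a)) b) (mul f d)) y.
Proof.
move=> hB; symmetry.
transitivity (sw (fun c d => sw (fun a b => sw (fun p q =>
   h (mul (mul c (S p)) (S a)) (mul b q)) d) f) y).
  etsum2; move=> c d; rewrite (sw_mul HH); last by slin.
  etsum2; move=> a b; etsum2; move=> p q.
  by rewrite antipM (amulA HH).
rewrite exchange_tsum2.
transitivity (sw (fun a b => sw (fun p q => h (S (mul a p)) (mul (mul b q) y)) one) f); last first.
  by rewrite -(sw_oner HH (h := fun a b => h (S a) (mul b y))) //; slin.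
etsum2; move=> a b.
rewrite -(sw_coassoc HH (fun c p q => h (mul (mul c (S p)) (S (bvec a))) (mul (bvec b) q))).
transitivity (sw (fun u q => h (mul (et u) (S (bvec a))) (mul (bvec b) q)) y).
  etsum2; move=> u q; rewrite /eps_t.
  by rewrite (tsum2_comp (f := fun z => h (mul z (S (bvec a))) (mul (bvec b) (bvec q)))) //; slin.
rewrite (sw_eps_t_l HH (h := fun u q => h (mul u (S (bvec a))) (mul (bvec b) q))) //; last by slin.
by etsum2; move=> p q; rewrite antipM (amulA HH).
Qed.

Definition trS2 (f : E) : C := \sum_t (mul f (S (S (bvec t)))) 0 t.

Lemma lin_trS2 : @lin C E C^o trS2.
Proof. by apply: lin_bigsum => t; slin. Qed.

(* Both sides are the trace of one composite of the maps x |-> S(x_1) (x) x_2,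
   x |-> g S^2(x) and y |-> y_1 (x) f y_2, cut open at different places. *)
Lemma trS2_pull f g :
  sw (fun c d => trS2 (mul f d) *: c) g = sw (fun a b => trS2 (mul b g) *: S a) f.
Proof.
transitivity (\sum_t sw (fun a b => sw (fun c d => (mul f d) 0 t *: mul c (S a))
    (mul g (S (S b)))) (bvec t)).
  transitivity (\sum_t sw (fun c d => (mul f (mul d (S (S (bvec t))))) 0 t *: c) g).
    transitivity (sw (fun c d => \sum_t (mul f (mul d (S (S (bvec t))))) 0 t *: c) g).
      etsum2; move=> c d; rewrite /trS2 scaler_suml.
      by apply: eq_bigr => t _; rewrite (amulA HH).
    by rewrite tsum2_sum.
  apply: eq_bigr => t _.
  by rewrite (sw_shift_antip2 (h := fun c d => (mul f d) 0 t *: c)) //; slin.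
transitivity (\sum_t sw (fun c d => sw (fun a b => b 0 t *: mul c (S a))
    (mul f d)) (mul g (S (S (bvec t))))); last first.
  transitivity (\sum_t sw (fun a b => (mul b (mul g (S (S (bvec t))))) 0 t *: S a) f).
    apply: eq_bigr => t _.
    by rewrite (sw_shift_antip (h := fun a b => b 0 t *: a)) //; slin.
  transitivity (sw (fun a b => \sum_t (mul b (mul g (S (S (bvec t))))) 0 t *: S a) f).
    by rewrite tsum2_sum.
  etsum2; move=> c d; rewrite /trS2 scaler_suml.
  by apply: eq_bigr => t _; rewrite (amulA HH).
transitivity (\sum_s \sum_t sw (fun a b => sw (fun c d =>
    (b 0 t * (mul f d) 0 s) *: mul c (S a)) (mul g (S (S (bvec t))))) (bvec s)).
  apply: eq_bigr => s _.
  transitivity (sw (fun a b => \sum_t sw (fun c d => (b 0 t * (mul f d) 0 s) *: mul c (S a))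
     (mul g (S (S (bvec t))))) (bvec s)).
    etsum2; move=> a b.
    rewrite (lin_expand (bvec b) (f := fun z => sw (fun c d => (mul f d) 0 s *: mul c (S (bvec a)))
      (mul g (S (S z))))); last by slin.
    apply: eq_bigr => t _; rewrite (tsum2_comp (f := fun z => (bvec b : E) 0 t *: z)); last by slin.
    by etsum2; move=> c d; rewrite scalerA.
  by rewrite tsum2_sum.
(* Interchanging the two sums over bases is tr(XY) = tr(YX). *)
rewrite exchange_big /=; apply: eq_bigr => t _.
transitivity (sw (fun c d => \sum_s sw (fun a b => (b 0 t * (mul f d) 0 s) *: mul c (S a)) (bvec s))
   (mul g (S (S (bvec t))))).
  rewrite tsum2_sum; apply: eq_bigr => s _; exact: exchange_tsum2.
etsum2; move=> c d.
rewrite (lin_expand (mul f (bvec d)) (f := fun z => sw (fun a b => b 0 t *: mul (bvec c) (S a)) z)); last by slin.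
apply: eq_bigr => s _; rewrite (tsum2_comp (f := fun z => (mul f (bvec d)) 0 s *: z)); last by slin.
by etsum2; move=> a b; rewrite scalerA mulrC.
Qed.

(* A partial quantum trace of the projection Delta(1) is a module map. *)
Lemma src_pivotal_central (chi : E -> C) f : @lin C E C^o chi ->
  (forall x y, chi (mul x y) = chi (mul y x)) ->
  let y := src H (fun b => chi (mul k b)) in mul y f = mul f y.
Proof.
move=> chiL chiC y.
have kS x : mul k x = mul (S (S x)) k by rewrite S2 (amulA HH) kik (amul1r HH).
rewrite /y /src (tsum2_comp (f := fun z => mul z f)); last by slin.
transitivity (sw (fun a b => chi (mul k (et b)) *: a) f).
  rewrite (sw_eps_t_r HH (h := fun a b => chi (mul k b) *: a)); last by slin.
  by etsum2; move=> a b; rewrite (linZ (f := fun z => mul z f)) //; slin.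
(* From S^2(p) k = k p and cyclicity, k p S(q) and S(S(p) q) k have the same [chi]. This passes from
   [et], which moves f to the right of the slice, to [es], which moves it to the left. *)
transitivity (sw (fun a b => chi (mul (S (es b)) k) *: a) f).
  etsum2; move=> a b; congr (_ *: _); rewrite /eps_t /eps_s.
  rewrite (tsum2_comp (M := C^o) (f := fun z => chi (mul k z))); last by slin.
  rewrite (tsum2_comp (M := C^o) (f := fun z => chi (mul (S z) k))); last by slin.
  etsum2; move=> p q.
  by rewrite -(amulA HH) kS chiC -(amulA HH) antipM.
rewrite (sw_eps_s_r HH (h := fun a b => chi (mul (S b) k) *: a)) //; last by slin.
rewrite (tsum2_comp (f := fun z => mul f z)); last by slin.
etsum2; move=> a b.
by rewrite -kS (linZ (f := fun z => mul f z)) //; slin.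
Qed.

End Pivotal.

(** * Density and Schur's lemma *)

Section Irreducible.
Variables (C : numClosedFieldType) (n : nat) (A : wha C n).
Hypothesis HA : is_weak_hopf A.
Notation E := 'rV[C]_n.

Lemma dmulA (f g h : E) : dmul A (dmul A f g) h = dmul A f (dmul A g h).
Proof. by rewrite -!amul_dual dual_mulA. Qed.

Lemma dmul1l (f : E) : dmul A (dunit A) f = f.
Proof. by rewrite -amul_dual; exact: (proj1 (dual_unit HA f)). Qed.

Lemma dmul1r (f : E) : dmul A f (dunit A) = f.
Proof. by rewrite -amul_dual; exact: (proj2 (dual_unit HA f)). Qed.

Lemma rep_lin m (rho : E -> 'M[C]_m) : is_alg_rep A rho -> lin rho.
Proof. by case. Qed.

Section OneRep.
Variables (m : nat) (rho : E -> 'M[C]_m).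
Hypotheses (rhoR : is_alg_rep A rho) (rhoI : irreducible_rep rho).

Let rhoL : lin rho := rep_lin rhoR.
Let rho1 : rho (dunit A) = 1%:M. Proof. by case: rhoR. Qed.
Let rhoM f g : rho (dmul A f g) = rho f *m rho g. Proof. by case: rhoR. Qed.

(** The orbit of [w] spans an invariant subspace that contains [w]. *)
Lemma irr_cyclic (w w' : 'cV[C]_m) : w != 0 -> exists f, rho f *m w = w'.
Proof.
move=> w0; pose L : 'M[C]_(n, m) := \matrix_i (rho (bvec i) *m w)^T.
have LE f : (rho f *m w)^T = f *m L.
  rewrite mulmx_sum_row (lin_expand f rhoL) mulmx_suml linear_sum; apply: eq_bigr => i _.
  by rewrite rowK -scalemxAl linearZ.
(* Irreducibility speaks of square matrices while [L] is n by m, hence the square generator of its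
   row space. *)
case: (rhoI.2 (<<L>>%MS)^T) => [f|/eqP U0|].
- rewrite trmx_mul trmxK (eqmxMr _ (genmxE L)) genmxE.
  apply/row_subP => i; rewrite row_mul rowK -trmx_mul mulmxA -rhoM LE.
  exact: submxMl.
- case/eqP: w0; have : (w^T <= L)%MS.
    by rewrite -[w]mul1mx -rho1 LE submxMl.
  have L0 : <<L>>%MS = 0 by rewrite -[<<L>>%MS]trmxK U0 trmx0.
  by rewrite -(genmxE L) L0 submx0 => /eqP /(congr1 trmx); rewrite trmxK trmx0.
rewrite trmxK => Lf; have : (w'^T <= L)%MS by rewrite -(genmxE L) submx_full.
case/submxP => f Ef; exists f; apply: trmx_inj; by rewrite LE Ef.
Qed.

(** The common kernel of all the rows u rho(f) is invariant, and it is proper because u itself is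
    such a row. *)
Lemma irr_cocyclic (u u' : 'rV[C]_m) : u != 0 -> exists f, u *m rho f = u'.
Proof.
move=> u0; pose L : 'M[C]_(n, m) := \matrix_i (u *m rho (bvec i)).
have LE f : u *m rho f = f *m L.
  rewrite [RHS]mulmx_sum_row (lin_expand f rhoL) mulmx_sumr; apply: eq_bigr => i _.
  by rewrite rowK -scalemxAr.
have LK : L *m (kermx L^T)^T = 0.
  by rewrite -[L]trmxK -trmx_mul trmxK mulmx_ker trmx0.
case: (rhoI.2 (kermx L^T)^T) => [f|/eqP U0|].
- rewrite trmxK; apply/sub_kermxP; rewrite -trmx_mul; apply: trmx_inj; rewrite trmxK trmx0.
  apply/row_matrixP => i; rewrite row0 !row_mul rowK mulmxA -(mulmxA u) -rhoM LE.
  by rewrite -mulmxA LK mulmx0.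
- have Lf : row_full L.
    rewrite /row_full -mxrank_tr -/(row_free _) -kermx_eq0.
    by rewrite -[kermx _]trmxK U0 trmx0.
  have /submxP [f Ef] : (u' <= L)%MS by rewrite submx_full.
  by exists f; rewrite LE.
rewrite trmxK => Kf; case/eqP: u0.
have : (1%:M <= kermx L^T)%MS by rewrite submx_full.
move/sub_kermxP; rewrite mul1mx => /(congr1 trmx); rewrite trmxK trmx0 => L0.
by rewrite -[u]mulmx1 -rho1 LE L0 mulmx0.
Qed.

(* A nonzero element of minimal rank has rank one: otherwise, writing it as X R with
   X and R of full rank r >= 2, some R rho(h) X is not scalar, and subtracting an
   eigenvalue lowers the rank. *)
Lemma irr_rank1 : exists f, \rank (rho f) = 1%N.
Proof.
suff H r f : \rank (rho f) = r -> (0 < r)%N -> exists g, \rank (rho g) = 1%N.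
  by apply: (H _ (dunit A) erefl); rewrite rho1 mxrank1; exact: rhoI.1.
elim/ltn_ind: r f => r IH f rf r0.
have [r1|r1] := leqP r 1; first by exists f; rewrite rf; apply/eqP; rewrite eqn_leq r1.
have [X [R [XR Xf Rf]]] : exists X : 'M[C]_(m, r), exists R : 'M[C]_(r, m),
    [/\ X *m R = rho f, row_full X & row_free R].
  have := And3 (mulmx_base (rho f)) (col_base_full (rho f)) (row_base_free (rho f)).
  by move: (col_base (rho f)) (row_base (rho f)); rewrite rf => X R ?; exists X, R.
pose i0 := Ordinal r0; pose i1 := Ordinal r1.
have c0 : col i0 X != 0.
  apply/eqP => c0; have : X *m delta_mx i0 (0 : 'I_1) = X *m 0.
    by rewrite -colE c0 mulmx0.
  move/(row_full_inj Xf) => /matrixP /(_ i0 0) /eqP.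
  by rewrite !mxE !eqxx oner_eq0.
have [j Rj] : exists j, R i1 j != 0.
  apply/existsP; apply: contraT => /existsPn R0; exfalso.
  have : delta_mx (0 : 'I_1) i1 *m R = 0 *m R.
    rewrite -rowE mul0mx; apply/rowP => j; rewrite !mxE.
    by apply/eqP; move: (R0 j); rewrite negbK.
  move/(row_free_inj Rf) => /matrixP /(_ 0 i1) /eqP.
  by rewrite !mxE !eqxx oner_eq0.
(* [h] sends column [i0] of X to the basis vector [j], so the off-diagonal entry (i1, i0) of R
   rho(h) X is [R i1 j]. It is nonzero and survives the subtraction of a scalar matrix. *)
have [h hE] := irr_cyclic (delta_mx j 0) c0.
pose M := R *m rho h *m X.
have M10 : M i1 i0 != 0.
  have -> : M i1 i0 = (M *m delta_mx i0 (0 : 'I_1)) i1 0 by rewrite -colE [RHS]mxE.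
  by rewrite /M -!mulmxA -colE hE -colE mxE.
have [mu] := eigenvalue_closed M r0; rewrite /eigenvalue /eigenspace => muE.
pose g := dmul A (dmul A f h) f - mu *: f.
have gE : rho g = X *m (M - mu%:M) *m R.
  rewrite /g addrC -scaleNr rhoL scaleNr addrC !rhoM -XR /M mulmxBr mulmxBl !mulmxA.
  by rewrite mul_mx_scalar -scalemxAl.
have gn0 : rho g != 0.
  apply: contra M10 => /eqP; rewrite gE => E0.
  have X0 : X *m (M - mu%:M) = 0 by apply: (row_free_inj Rf); rewrite /= E0 mul0mx.
  move: X0; rewrite -(mulmx0 _ X) => /(row_full_inj Xf) /matrixP /(_ i1 i0).
  by rewrite !mxE -[i1 == i0]/false mulr0n subr0 => ->.
apply: (IH (\rank (rho g)) _ g erefl); last by rewrite lt0n mxrank_eq0.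
rewrite gE; apply: leq_ltn_trans (mxrankM_maxl _ _) _.
apply: leq_ltn_trans (mxrankM_maxr _ _) _.
by rewrite ltn_neqAle rank_leq_row andbT -/(row_free _) -kermx_eq0.
Qed.

(** Burnside's theorem: cyclicity on both sides carries a rank-one element to every matrix unit. *)
Lemma irr_onto (X : 'M[C]_m) : exists f, rho f = X.
Proof.
have [g gr] := irr_rank1.
have [x [u xu]] : exists x : 'cV[C]_m, exists u : 'rV[C]_m, rho g = x *m u.
  rewrite -[rho g]mulmx_base.
  by move: (col_base (rho g)) (row_base (rho g)); rewrite gr => x u; exists x, u.
have g0 : rho g != 0 by rewrite -mxrank_eq0 gr.
have x0 : x != 0 by apply: contra g0 => /eqP x0; rewrite xu x0 mul0mx.
have u0 : u != 0 by apply: contra g0 => /eqP u0; rewrite xu u0 mulmx0.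
have dE p q : exists f, rho f = delta_mx p q.
  have [f1 E1] := irr_cyclic (delta_mx p 0) x0.
  have [f2 E2] := irr_cocyclic (delta_mx 0 q) u0.
  exists (dmul A (dmul A f1 g) f2); rewrite !rhoM xu mulmxA E1 -mulmxA E2.
  by rewrite mul_delta_mx.
have [F HF] : exists F : 'I_m -> 'I_m -> E, forall p q, rho (F p q) = delta_mx p q.
  have fin1 p : exists F : {ffun 'I_m -> E}, forall q, rho (F q) = delta_mx p q.
    have := fin_all_exists (dE p); case=> F HF; exists [ffun q => F q] => q.
    by rewrite ffunE HF.
  by have [F HF] := fin_all_exists fin1; exists F.
exists (\sum_p \sum_q X p q *: F p q).
rewrite (lin_sum _ _ _ rhoL) [RHS]matrix_sum_delta; apply: eq_bigr => p _.
rewrite (lin_sum _ _ _ rhoL); apply: eq_bigr => q _.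
by rewrite (linZ rhoL) HF.
Qed.

End OneRep.

(** Schur's lemma: the column space of P is invariant under [rho1], its kernel under [rho2]. *)
Lemma irr_schur m1 m2 (rho1 : E -> 'M[C]_m1) (rho2 : E -> 'M[C]_m2) (P : 'M[C]_(m1, m2)) :
  irreducible_rep rho1 -> irreducible_rep rho2 ->
  (forall f, rho1 f *m P = P *m rho2 f) -> P != 0 -> rep_iso rho1 rho2.
Proof.
move=> I1 I2 hom P0.
have Pfree : row_free P.
  rewrite /row_free -mxrank_tr; case: (I1.2 (<<P^T>>%MS)^T) => [f|/eqP U0|].
  - rewrite trmx_mul trmxK (eqmxMr _ (genmxE P^T)) genmxE -trmx_mul hom trmx_mul.
    exact: submxMl.
  - case/eqP: P0; apply: trmx_inj; rewrite trmx0; apply/eqP.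
    by rewrite -mxrank_eq0 -mxrank_gen -[<<_>>%MS]trmxK U0 trmx0 mxrank0.
  by rewrite trmxK /row_full genmxE.
have Pfull : row_full P.
  rewrite /row_full -mxrank_tr -/(row_free _) -kermx_eq0.
  have PK : P *m (kermx P^T)^T = 0.
    by rewrite -[P]trmxK -trmx_mul trmxK mulmx_ker trmx0.
  case: (I2.2 (kermx P^T)^T) => [f|/eqP U0|].
  - rewrite trmxK; apply/sub_kermxP; rewrite -trmx_mul mulmxA -hom -mulmxA PK mulmx0.
    by rewrite trmx0.
  - by rewrite -[kermx _]trmxK U0 trmx0.
  rewrite trmxK => Kf; case/eqP: P0.
  have : (1%:M <= kermx P^T)%MS by rewrite submx_full.
  by move/sub_kermxP; rewrite mul1mx => /(congr1 trmx); rewrite trmxK trmx0.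
by exists P, (pinvmx P); split; rewrite ?mulmxVp ?mulVpmx.
Qed.

End Irreducible.

(** * Wedderburn decomposition of the dual *)

Section Wedderburn.
Variables (C : numClosedFieldType) (n : nat) (A : wha C n).
Hypotheses (HA : is_weak_hopf A) (Hss : dual_semisimple A).
Notation E := 'rV[C]_n.
Variables (I : finType) (na : I -> nat) (psi : forall a : I, E -> 'M[C]_(na a)).
Hypothesis Hrep : forall a, is_alg_rep A (psi a).
Hypothesis Hirr : forall a, irreducible_rep (psi a).
Hypothesis Hdist : forall a b, rep_iso (psi a) (psi b) -> a = b.
Hypothesis Hcompl : forall m (rho : E -> 'M[C]_m),
  is_alg_rep A rho -> irreducible_rep rho -> exists a, rep_iso rho (psi a).

Lemma psi_lin a : lin (psi a). Proof. exact: rep_lin. Qed.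
Lemma psi_one a : psi a (dunit A) = 1%:M. Proof. by case: (Hrep a). Qed.
Lemma psi_mul a f g : psi a (dmul A f g) = psi a f *m psi a g.
Proof. by case: (Hrep a). Qed.

(** Makes the kernel of [psi a] a row space, so that inclusion of kernels can be decided. *)
Definition rep_mx a : 'M[C]_(n, na a * na a) := \matrix_i mxvec (psi a (bvec i)).

Lemma rep_mxE a f : mxvec (psi a f) = f *m rep_mx a.
Proof.
rewrite mulmx_sum_row (lin_expand f (psi_lin a)) linear_sum; apply: eq_bigr => i _.
by rewrite rowK linearZ.
Qed.

(** If the kernel of [psi c] is not inside that of [psi a], its image under [psi a] is a nonzero
    two-sided ideal of a matrix algebra and contains 1. Otherwise [psi a] factors through End(W_c),
    and an intertwiner contradicts inequivalence. *)
Lemma psi_separate a c : a != c -> exists f, psi a f = 1%:M /\ psi c f = 0.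
Proof.
move=> aDc; have [/rV_subP sub|/row_subPn [t]] :=
  boolP (kermx (rep_mx c) <= kermx (rep_mx a))%MS; last first.
  set f := row t _ => fa.
  have fc : psi c f = 0.
    apply: (can_inj mxvecK); rewrite rep_mxE linear0; apply/sub_kermxP; exact: row_sub.
  have {fa} : psi a f != 0.
    apply: contra fa => /eqP fa; apply/sub_kermxP; by rewrite -rep_mxE fa linear0.
  case/matrix0Pn => p [q fpq].
  have [G HG] := fin_all_exists (fun i => irr_onto (Hrep a) (Hirr a) (delta_mx i p)).
  have [K HK] := fin_all_exists (fun i => irr_onto (Hrep a) (Hirr a) (delta_mx q i)).
  exists ((psi a f p q)^-1 *: \sum_i dmul A (dmul A (G i) f) (K i)); split.
    rewrite (linZ (psi_lin a)) (lin_sum _ _ _ (psi_lin a)).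
    under eq_bigr => i _ do rewrite !psi_mul HG HK delta_mx_sandwich.
    by rewrite -scaler_sumr scalerA mulVf // scale1r [RHS]mx1_sum_delta.
  rewrite (linZ (psi_lin c)) (lin_sum _ _ _ (psi_lin c)).
  rewrite big1 ?scaler0 // => i _; by rewrite !psi_mul fc mulmx0 mul0mx.
have ker f : psi c f = 0 -> psi a f = 0.
  move=> fc; apply: (can_inj mxvecK); rewrite rep_mxE linear0; apply/sub_kermxP.
  by apply: sub; apply/sub_kermxP; rewrite -rep_mxE fc linear0.
have ker2 f g : psi c f = psi c g -> psi a f = psi a g.
  move=> fg; apply/eqP; rewrite -subr_eq0; apply/eqP.
  have -> : psi a f - psi a g = psi a (- 1 *: g + f) by rewrite (psi_lin a) scaleN1r addrC.
  by apply: ker; rewrite (psi_lin c) scaleN1r fg addNr.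
pose i0 := Ordinal (Hirr c).1.
have [F HF] := fin_all_exists (fun i => irr_onto (Hrep c) (Hirr c) (delta_mx i i0)).
have [G HG] := fin_all_exists (fun i => irr_onto (Hrep c) (Hirr c) (delta_mx i0 i)).
have Fsum : psi a (\sum_i dmul A (F i) (G i)) = 1%:M.
  rewrite -(psi_one a); apply: ker2; rewrite (lin_sum _ _ _ (psi_lin c)) psi_one mx1_sum_delta.
  by apply: eq_bigr => i _; rewrite psi_mul HF HG mul_delta_mx.
have [j [p Pp]] : exists j, exists p, col p (psi a (F j)) != 0.
  suff /existsP [j /existsP [p Hp]] : [exists j, [exists p, col p (psi a (F j)) != 0]].
    by exists j, p.
  apply: contraT => /existsPn H; move: Fsum.
  rewrite (lin_sum _ _ _ (psi_lin a)) big1 => [/eqP|j _].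
    rewrite eq_sym -mxrank_eq0 mxrank1; have := (Hirr a).1; by case: (na a).
  rewrite psi_mul (_ : psi a (F j) = 0) ?mul0mx //.
  apply/matrixP => s t; have /existsPn /(_ t) := H j; rewrite negbK => /eqP /colP /(_ s).
  by rewrite !mxE.
(* The elements [F t] lift the matrix units of one column, so modulo the kernel of [psi c] left
   multiplication permutes them as W_c. Applying [psi a] and taking column [p] gives the
   intertwiner, nonzero by the choice of [p]. *)
pose P : 'M[C]_(na a, na c) := \matrix_(s, t) psi a (F t) s p.
have colP' t : col t P = psi a (F t) *m delta_mx p (0 : 'I_1).
  by rewrite -colE; apply/colP => s; rewrite !mxE.
exfalso; case/eqP: aDc; apply: Hdist; apply: (irr_schur (P := P)) => // [f|].
  suff Hcol t : col t (psi a f *m P) = col t (P *m psi c f).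
    by apply/matrixP => s t; have /colP /(_ s) := Hcol t; rewrite mxE [in RHS]mxE.
  have cM x y z (X : 'M[C]_(x, y)) (Y : 'M[C]_(y, z)) j' : col j' (X *m Y) = X *m col j' Y.
    by rewrite !colE mulmxA.
  rewrite !cM colP' mulmxA -psi_mul.
  rewrite (ker2 _ (\sum_s psi c f s t *: F s)).
    rewrite (lin_sum _ _ _ (psi_lin a)) mulmx_suml.
    have -> : P *m col t (psi c f) = \sum_s psi c f s t *: col s P.
      apply/colP => s; rewrite mxE summxE; apply: eq_bigr => s' _.
      by rewrite !mxE mulrC.
    by apply: eq_bigr => s _; rewrite (linZ (psi_lin a)) -scalemxAl colP'.
  rewrite psi_mul HF (lin_sum _ _ _ (psi_lin c)).
  under [RHS]eq_bigr => s _ do rewrite (linZ (psi_lin c)) HF.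
  apply/matrixP => s s'; rewrite summxE mxE (bigD1 t) //= big1 ?addr0 => [|s'' ts].
    rewrite (bigD1 s) //= big1 ?addr0 => [|s'' ts].
      by rewrite !mxE !eqxx.
    by rewrite !mxE eq_sym (negbTE ts) mulr0.
  by rewrite !mxE (negbTE ts) mulr0.
apply: contra Pp => /eqP P0.
by rewrite colE -colP' P0 col0.
Qed.

(** A Chinese remainder argument: multiply the separating elements for all the other blocks. *)
Lemma psi_block_unit a : exists e, psi a e = 1%:M /\ forall c, c != a -> psi c e = 0.
Proof.
suff H (s : seq I) : exists e, psi a e = 1%:M /\ forall c, c \in s -> c != a -> psi c e = 0.
  by have [e [e1 e0]] := H (enum I); exists e; split=> // c; apply: e0; rewrite mem_enum.
elim: s => [|c s [e [e1 e0]]]; first by exists (dunit A); split=> //; exact: psi_one.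
have [->|ca] := eqVneq c a.
  by exists e; split=> // c'; rewrite inE => /orP [/eqP ->|/e0 //]; rewrite eqxx.
have [f [f1 f0]] : exists f, psi a f = 1%:M /\ psi c f = 0.
  by apply: psi_separate; rewrite eq_sym.
exists (dmul A e f); split; first by rewrite psi_mul e1 f1 mul1mx.
move=> c'; rewrite inE psi_mul => /orP [/eqP -> _|/e0 H /H ->]; last by rewrite mul0mx.
by rewrite f0 mulmx0.
Qed.

Lemma psi_matrix_units : exists Eu : forall a, 'I_(na a) -> 'I_(na a) -> E,
  (forall a i j, psi a (Eu a i j) = delta_mx i j) /\
  (forall a c i j, c != a -> psi c (Eu a i j) = 0).
Proof.
have H a : exists F : 'I_(na a) -> 'I_(na a) -> E,
    (forall i j, psi a (F i j) = delta_mx i j) /\ (forall c i j, c != a -> psi c (F i j) = 0).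
  have [e [e1 e0]] := psi_block_unit a.
  have H1 i : exists F : 'I_(na a) -> E, forall j, psi a (F j) = delta_mx i j.
    by have [F HF] := fin_all_exists (fun j => irr_onto (Hrep a) (Hirr a) (delta_mx i j)); exists F.
  have [F HF] := fin_all_exists H1.
  exists (fun i j => dmul A e (F i j)); split=> [i j|c i j ca]; rewrite psi_mul.
    by rewrite e1 mul1mx HF.
  by rewrite e0 // mul0mx.
have [Eu HEu] := fin_all_exists H.
by exists Eu; split=> [a i j|a c i j]; have [H1 H2] := HEu a; [exact: H1 | exact: H2].
Qed.

Definition lmul_mx (f : E) : 'M[C]_n := \matrix_i dmul A f (bvec i).

Lemma lmul_mxE f g : g *m lmul_mx f = dmul A f g.
Proof.
rewrite mulmx_sum_row (lin_expand g (proj2 (bilin_dmul A) f)); apply: eq_bigr => i _.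
by rewrite rowK.
Qed.

Lemma lmul_mx_lin : lin lmul_mx.
Proof.
move=> c f g; apply/row_matrixP => i; rewrite linearP /= !rowK.
exact: (proj1 (bilin_dmul A) (bvec i)).
Qed.

(** By induction on the rank, a nonzero L may be taken minimal. Left multiplication on L is then
    irreducible, hence isomorphic to some [psi a], so L kills itself; an ideal with L L = 0 and a
    complement is zero. *)
Lemma killed_left_ideal0 (L : 'M[C]_n) : left_ideal A L ->
  (forall g : E, (g <= L)%MS -> forall a, psi a g = 0) -> L = 0.
Proof.
move: {2}(\rank L) (erefl (\rank L)) => r; elim/ltn_ind: r L => r IH L rL Lid Lk.
apply/eqP; rewrite -mxrank_eq0 rL; apply: contraT => r0; exfalso.
have IH' (L1 : 'M[C]_n) : left_ideal A L1 -> (L1 <= L)%MS -> (\rank L1 < r)%N -> L1 = 0.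
  by move=> L1id sL r1; apply: (IH _ r1 _ erefl) => // g g1; apply: Lk; exact: submx_trans g1 sL.
have [R [RL Rf]] : exists R : 'M[C]_(r, n), (R :=: L)%MS /\ row_free R.
  have := conj (eq_row_base L) (row_base_free L).
  by move: (row_base L); rewrite rL => R ?; exists R.
have Rst f : (R *m lmul_mx f <= R)%MS.
  apply/row_subP => i; rewrite row_mul lmul_mxE RL; apply: Lid; rewrite -RL; exact: row_sub.
(* Left multiplication in the basis [R] of L, transposed because representations act on columns. *)
pose rho f : 'M[C]_r := (R *m lmul_mx f *m pinvmx R)^T.
have rhoE f : (rho f)^T *m R = R *m lmul_mx f by rewrite /rho trmxK mulmxKpV.
have rhoR : is_alg_rep A rho.
  split=> [c f g||f g].
  - by rewrite /rho lmul_mx_lin mulmxDr mulmxDl -scalemxAr -scalemxAl linearP.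
  - apply: trmx_inj; rewrite trmx1; apply: (row_free_inj Rf); rewrite /= rhoE mul1mx.
    by apply/row_matrixP => i; rewrite row_mul lmul_mxE dmul1l.
  apply: trmx_inj; apply: (row_free_inj Rf); rewrite /= rhoE trmx_mul -mulmxA rhoE mulmxA rhoE.
  by apply/row_matrixP => i; rewrite !row_mul !lmul_mxE -dmulA.
have rhoI : irreducible_rep rho.
  split; first by rewrite lt0n.
  move=> U Ust; have [Uf|Uf] := boolP (row_full U^T); [by right | left].
  have L1 : <<U^T *m R>>%MS = 0 :> 'M[C]_n.
    apply: IH'.
    - move=> f g; rewrite !genmxE => /submxP [D ->].
      rewrite -lmul_mxE -!mulmxA -rhoE [_ *m (_ *m R)]mulmxA.
      apply: submx_trans (submxMl _ _) _; apply: submxMr.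
      by rewrite -trmx_mul.
    - by rewrite genmxE -RL submxMl.
    rewrite mxrank_gen mxrankMfree // ltn_neqAle rank_leq_row andbT.
    by rewrite /row_full in Uf.
  have : U^T *m R = 0 *m R.
    by rewrite mul0mx; apply/eqP; rewrite -mxrank_eq0 -mxrank_gen L1 mxrank0.
  by move/(row_free_inj Rf) => /(congr1 trmx); rewrite trmxK trmx0 => ->.
have [a [P [Q [PQ _ hom]]]] := Hcompl rhoR rhoI.
have rho0 f : (f <= L)%MS -> rho f = 0.
  move=> fL; rewrite -[rho f]mulmx1 -PQ mulmxA hom Lk // mulmx0; exact: mul0mx.
have LL f g : (f <= L)%MS -> (g <= L)%MS -> dmul A f g = 0.
  move=> fL; rewrite -RL => /submxP [D ->]; rewrite -lmul_mxE -mulmxA -rhoE rho0 //.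
  by rewrite trmx0 mul0mx mulmx0.
have [L' [L'id /eqP LL' full]] := Hss Lid.
have cap0 (f : E) : (f <= L)%MS -> (f <= L')%MS -> f = 0.
  by move=> f1 f2; apply/eqP; rewrite -submx0 -LL' sub_capmx f1.
have [D E1] : exists D : 'M[C]_(1, n) * 'M[C]_(1, n), dunit A = D.1 *m L + D.2 *m L'.
  by have /sub_addsmxP [D ->] : (dunit A <= L + L')%MS by [rewrite submx_full]; exists D.
have eL : (D.1 *m L <= L)%MS by exact: submxMl.
(* Writing 1 = e + e' along L and L', the identity e = e e + e e' with e e = 0 places e in both
   ideals. *)
have e0 : D.1 *m L = 0.
  apply: cap0 => //; rewrite -(dmul1r HA (D.1 *m L)) E1 (linD (proj2 (bilin_dmul A) _)).
  by rewrite (LL _ _ eL eL) add0r; apply: L'id; exact: submxMl.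
case/negP: r0; rewrite -rL mxrank_eq0; apply/eqP/row_matrixP => i; rewrite row0.
apply: cap0; first exact: row_sub.
by rewrite -(dmul1r HA (row i L)) E1 e0 add0r; apply: L'id; exact: submxMl.
Qed.

Lemma psi_faithful f : (forall a, psi a f = 0) -> f = 0.
Proof.
move=> f0; pose L : 'M[C]_n := \matrix_i dmul A (bvec i) f.
have LE g : g *m L = dmul A g f.
  rewrite mulmx_sum_row (lin_expand g (proj1 (bilin_dmul A) f)).
  by apply: eq_bigr => i _; rewrite rowK.
have L0 : L = 0.
  apply: killed_left_ideal0.
    by move=> g h /submxP [D ->]; rewrite LE -dmulA // -LE submxMl.
  by move=> g /submxP [D ->] a; rewrite LE psi_mul f0 mulmx0.
by rewrite -(dmul1l HA f) -LE L0 mulmx0.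
Qed.

Lemma psi_inj f g : (forall a, psi a f = psi a g) -> f = g.
Proof.
move=> fg; apply/eqP; rewrite -subr_eq0; apply/eqP; apply: psi_faithful => a.
by rewrite addrC -scaleN1r (psi_lin a) scaleN1r fg addNr.
Qed.

End Wedderburn.

(** * Dimensions in a fusion ring *)

Section FusionDimensions.
Variables (C : numClosedFieldType) (I : finType) (N : I -> I -> I -> nat).
Variables (l r bar : I -> I) (D : I -> C).
Hypothesis barK : forall a, bar (bar a) = a.
Hypothesis fus_l : forall a b c, N a b c != 0 -> l a = l c.
Hypothesis fus_m : forall a b c, N a b c != 0 -> r a = l b.
Hypothesis l_bar : forall a, l (bar a) = r a.
Hypothesis frob : forall a b c, N a b c = N (bar a) c b.
Hypothesis dimM : forall a b, \sum_c (N a b c)%:R * D c = (r a == l b)%:R * (D a * D b).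
Hypothesis dim_bar : forall a, D (bar a) = D a.
Hypothesis dim_neq0 : forall a, D a != 0.

Definition gdim (e : I) : C := \sum_(x | l x == e) D x ^+ 2.

Let r_bar a : r (bar a) = l a. Proof. by rewrite -l_bar barK. Qed.

(** Both sides evaluate the double sum of N_{ax}^y F(x) D(y): over y by multiplicativity of D, and
    over x by reciprocity and multiplicativity of F. *)
Lemma fusion_pairing (F : I -> C) a :
  (forall a b, \sum_c (N a b c)%:R * F c = (r a == l b)%:R * (F a * F b)) ->
  (forall a, F (bar a) = F a) ->
  D a * (\sum_(x | l x == r a) D x * F x) = F a * (\sum_(x | l x == l a) D x * F x).
Proof.
move=> FM Fbar.
transitivity (\sum_x F x * \sum_y (N a x y)%:R * D y).
  rewrite mulr_sumr [LHS]big_mkcond /=; apply: eq_bigr => x _.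
  rewrite dimM eq_sym; case: eqP => _; last by rewrite mul0r mulr0.
  by rewrite mul1r; ring.
transitivity (\sum_y D y * \sum_x (N (bar a) y x)%:R * F x); last first.
  rewrite mulr_sumr [RHS]big_mkcond /=; apply: eq_bigr => x _.
  rewrite FM r_bar eq_sym; case: eqP => _; last by rewrite mul0r mulr0.
  by rewrite mul1r Fbar mulrCA.
under eq_bigr => x _ do rewrite mulr_sumr.
under [RHS]eq_bigr => x _ do rewrite mulr_sumr.
rewrite exchange_big; apply: eq_bigr => x _; apply: eq_bigr => y _ /=.
by rewrite frob; ring.
Qed.

(** The pairing with the conjugate character reads D_a M(r_a) = conj(D_a) M(l_a) with M nonnegative
    and M(l_a) positive. Absolute values give M(r_a) = M(l_a), and cancelling leaves D_a real. *)
Lemma dim_conj a : (D a)^* = D a.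
Proof.
have H := @fusion_pairing (fun x => (D x)^*) a.
have {}H : D a * (\sum_(x | l x == r a) D x * (D x)^*)
           = (D a)^* * (\sum_(x | l x == l a) D x * (D x)^*).
  apply: H => [x y|x]; last by rewrite dim_bar.
  rewrite -rmorphM -[X in X * _](rmorph_nat (@Num.conj C)) -rmorphM -dimM rmorph_sum.
  by apply: eq_bigr => z _; rewrite rmorphM rmorph_nat.
have M0 e : 0 <= \sum_(x | l x == e) D x * (D x)^*.
  by apply: sumr_ge0 => x _; rewrite mul_conjC_ge0.
have Ml : 0 < \sum_(x | l x == l a) D x * (D x)^*.
  rewrite (bigD1 a) //=; apply: ltr_pwDl; first by rewrite mul_conjC_gt0.
  by apply: sumr_ge0 => x _; rewrite mul_conjC_ge0.
have E : \sum_(x | l x == r a) D x * (D x)^* = \sum_(x | l x == l a) D x * (D x)^*.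
  have := congr1 Num.norm H; rewrite !normrM norm_conjC.
  move/(mulfI _); rewrite normr_eq0 => /(_ (dim_neq0 a)).
  by rewrite !ger0_norm.
by move: H; rewrite E => /(mulIf (lt0r_neq0 Ml)).
Qed.

Lemma gdim_neq0 a : gdim (l a) != 0.
Proof.
have sq x : 0 < D x ^+ 2 by rewrite expr2 -{2}[D x]dim_conj mul_conjC_gt0.
apply: lt0r_neq0; rewrite /gdim (bigD1 a) //=.
by apply: ltr_pwDl => //; apply: sumr_ge0 => x _; exact: ltW.
Qed.

Lemma gdim_lr a : gdim (r a) = gdim (l a).
Proof. by have := fusion_pairing a dimM dim_bar => /(mulfI (dim_neq0 a)). Qed.

(** All normalisations that meet a nonzero N_{ab}^c equal G. Reciprocity makes the sum over b equal
    to D_{bar a} D_c, and the remaining sum of D_a^2 over l_a = l_c cancels one factor G. *)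
Lemma fusion_idempotent c :
  \sum_a \sum_b (D a / gdim (l a)) * (D b / gdim (l b)) * (N a b c)%:R = D c / gdim (l c).
Proof.
set G := gdim (l c); have G0 : G != 0 by exact: gdim_neq0.
transitivity (\sum_a (D a / G / G) * \sum_b (N (bar a) c b)%:R * D b).
  apply: eq_bigr => a _; rewrite mulr_sumr; apply: eq_bigr => b _; rewrite -frob.
  have [->|Nn0] := eqVneq (N a b c) 0%N; first by rewrite !mul0r !mulr0.
  rewrite -(fus_m Nn0) gdim_lr (fus_l Nn0) -/G.
  by ring.
transitivity (\sum_a (if l a == l c then D a ^+ 2 else 0) * (D c / G / G)).
  apply: eq_bigr => a _; rewrite dimM r_bar; case: eqP => _; last by rewrite !mul0r mulr0.
  by rewrite dim_bar mul1r; ring.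
rewrite -mulr_suml -big_mkcond /= -/(gdim _) -/G.
by rewrite mulrC divfK.
Qed.

End FusionDimensions.

(** * Kronecker products, traces and casts *)

Section Kron.
Variable C : fieldType.

Lemma kronE m1 n1 m2 n2 (P : 'M[C]_(m1, n1)) (Q : 'M[C]_(m2, n2)) i1 i2 j1 j2 :
  kron P Q (mxvec_index i1 i2) (mxvec_index j1 j2) = P i1 j1 * Q i2 j2.
Proof.
rewrite /kron summxE (bigD1 i1) //= summxE (bigD1 j1) //= summxE (bigD1 i2) //= summxE (bigD1 j2) //=.
rewrite !mxE !eqxx mulr1.
rewrite big1 ?addr0 => [|k kj]; last by rewrite !mxE !mxvec_index_eq [j2 == k]eq_sym (negbTE kj) !andbF mulr0.
rewrite big1 ?addr0 => [|k kj]; last first.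
  by rewrite summxE big1 // => s _; rewrite !mxE !mxvec_index_eq [i2 == k]eq_sym (negbTE kj) !andbF mulr0.
rewrite big1 ?addr0 => [|k kj]; last first.
  rewrite summxE big1 // => s _; rewrite summxE big1 // => t _.
  by rewrite !mxE !mxvec_index_eq [j1 == k]eq_sym (negbTE kj) !andbF mulr0.
rewrite big1 ?addr0 // => k kj.
rewrite summxE big1 // => s _; rewrite summxE big1 // => t _; rewrite summxE big1 // => q _.
by rewrite !mxE !mxvec_index_eq [i1 == k]eq_sym (negbTE kj) mulr0.
Qed.

Lemma sum_mxvec_index (V : nmodType) m p (F : 'I_(m * p) -> V) :
  \sum_k F k = \sum_i \sum_j F (mxvec_index i j).
Proof.
rewrite (reindex _ (curry_mxvec_bij m p)) [RHS]pair_bigA /=.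
by apply: eq_bigr => -[i j].
Qed.

Lemma mxtrace_kron m1 m2 (P : 'M[C]_m1) (Q : 'M[C]_m2) : \tr (kron P Q) = \tr P * \tr Q.
Proof.
rewrite /mxtrace sum_mxvec_index mulr_suml; apply: eq_bigr => i _.
by rewrite mulr_sumr; apply: eq_bigr => j _; rewrite kronE.
Qed.

Lemma scalar_of_central m (X : 'M[C]_m) (i0 : 'I_m) :
  (forall Y, X *m Y = Y *m X) -> X = (X i0 i0)%:M.
Proof.
move=> cX; rewrite -[LHS]mulmx1 -[RHS]scalemx1 mx1_sum_delta mulmx_sumr scaler_sumr.
apply: eq_bigr => i _; rewrite -[in LHS](mul_delta_mx i0 i i) mulmxA cX.
exact: delta_mx_sandwich.
Qed.

Lemma lin_trace m : @lin C 'M[C]_m C^o (fun X => (\tr X : C)).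
Proof. by move=> c X Y; rewrite linearP. Qed.

Lemma castmx_mul m p q p' (e : p = p') (X : 'M[C]_(m, p)) (Y : 'M[C]_(p, q)) :
  castmx (erefl m, e) X *m castmx (e, erefl q) Y = X *m Y.
Proof. by case: _ / e; rewrite !castmx_id. Qed.

End Kron.

(** * Spherical duals *)

Section Spherical.
Variables (C : numClosedFieldType) (n : nat) (A : wha C n).
Hypotheses (HA : is_weak_hopf A) (Hss : dual_semisimple A).
Notation E := 'rV[C]_n.
Variables (I : finType) (na : I -> nat) (psi : forall a : I, E -> 'M[C]_(na a)).
Hypothesis Hrep : forall a, is_alg_rep A (psi a).
Hypothesis Hirr : forall a, irreducible_rep (psi a).
Hypothesis Hdist : forall a b, rep_iso (psi a) (psi b) -> a = b.
Hypothesis Hcompl : forall m (rho : E -> 'M[C]_m),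
  is_alg_rep A rho -> irreducible_rep rho -> exists a, rep_iso rho (psi a).
Variable b : forall a, 'M[C]_(na a).
Hypothesis Hb : forall f, ev f (wone A) = \sum_a \tr (b a *m psi a f).
Variables (v : forall a, 'cV[C]_(na a)) (u : forall a, 'rV[C]_(na a)).
Hypothesis Hvu : forall e, b e != 0 -> b e = v e *m u e.
Variable N : I -> I -> I -> nat.
Variable V : forall a b c, 'I_(N a b c) -> 'M[C]_(na a * na b, na c).
Variable W : forall a b c, 'I_(N a b c) -> 'M[C]_(na c, na a * na b).
Arguments V : clear implicits.
Arguments W : clear implicits.
Hypothesis HVW : forall a b f, tens_rep A (psi a) (psi b) f
  = \sum_c \sum_(mu < N a b c) V a b c mu *m psi c f *m W a b c mu.
Hypothesis HWV1 : forall a b c (mu nu : 'I_(N a b c)),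
  W a b c mu *m V a b c nu = (mu == nu)%:R%:M.
Variables (l r : I -> I).
Hypothesis Hl : forall a, b (l a) != 0 /\
  forall e c, b e != 0 -> N e a c = ((e == l a) && (a == c)) :> nat.
Hypothesis Hr : forall a, b (r a) != 0 /\
  forall e c, b e != 0 -> N a e c = ((e == r a) && (a == c)) :> nat.
Variables (bar : I -> I) (barK : forall a, bar (bar a) = a).
Variables (Z : forall a, 'M[C]_(na a, na (bar a))) (Zi : forall a, 'M[C]_(na (bar a), na a)).
Hypothesis HZ : forall a, Z a *m Zi a = 1%:M /\ Zi a *m Z a = 1%:M.
Hypothesis HZconj : forall a f, (psi a (dS A f))^T = Z a *m psi (bar a) f *m Zi a.

Notation D := (dual A).
Notation mul := (amul D).
Notation one := (wone D).
Notation S := (antip D).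
Notation "'sw' h x" := (tsum2 h (comul D x)) (at level 10, h at level 9, x at level 9).

Let HD : is_weak_hopf D := is_weak_hopf_dual HA.

Let psiL a : lin (psi a) := psi_lin Hrep a.
Let psi1 a : psi a one = 1%:M. Proof. exact: (psi_one Hrep). Qed.
Let psiM a f g : psi a (mul f g) = psi a f *m psi a g.
Proof. by rewrite amul_dual (psi_mul Hrep). Qed.
Let psi_ext f g : (forall a, psi a f = psi a g) -> f = g.
Proof. exact: (psi_inj HA Hss Hrep Hcompl). Qed.

Let psiS a f : psi a (S f) = (Z a *m psi (bar a) f *m Zi a)^T.
Proof. by rewrite antip_dual -HZconj trmxK. Qed.

(** Block by block, S is the transpose of a conjugated representation, and transposition reverses
    products; faithfulness concludes. *)
Lemma dual_antipM f g : S (mul f g) = mul (S g) (S f).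
Proof.
apply: psi_ext => a; rewrite psiM !psiS -trmx_mul psiM; congr (_^T).
by rewrite -!mulmxA (mulmxA (Zi a) (Z a)) (proj2 (HZ a)) mul1mx.
Qed.

(** * Characters and the fusion ring *)

Definition chi a f : C := \tr (psi a f).

Lemma lin_chi a : @lin C E C^o (chi a).
Proof. by move=> c f g; rewrite /chi psiL linearP. Qed.

Lemma chiC a f g : chi a (mul f g) = chi a (mul g f).
Proof. by rewrite /chi !psiM mxtrace_mulC. Qed.

Lemma chi_antip a f : chi a (S f) = chi (bar a) f.
Proof. by rewrite /chi psiS mxtrace_tr mxtrace_mulC mulmxA (proj2 (HZ a)) mul1mx. Qed.

Lemma tens_repE a c f : tens_rep A (psi a) (psi c) f
  = tsum2 (fun x y => kron (psi a x) (psi c y)) (comul D f).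
Proof. by rewrite /tens_rep comul_dual. Qed.

Lemma fusion_chi a c f :
  tsumC (fun x y => (chi a x * chi c y : C)) (comul D f) = \sum_d (N a c d)%:R * chi d f.
Proof.
transitivity (\tr (tens_rep A (psi a) (psi c) f)).
  rewrite tens_repE (tsum2_comp _ _ (@lin_trace C _)).
  by etsum2; move=> i j; rewrite mxtrace_kron.
rewrite HVW linear_sum; apply: eq_bigr => d _; rewrite linear_sum /=.
transitivity (\sum_(mu < N a c d) chi d f); last by rewrite sumr_const card_ord mulr_natl.
apply: eq_bigr => mu _; rewrite mxtrace_mulC mulmxA HWV1 eqxx.
by rewrite mul1mx.
Qed.

(** The character seen as an element of [A], the dual of the dual; these elements span a copy of the
    fusion ring, so associativity of [A] constrains N. *)
Definition Xchi a : E := \row_i chi a (bvec i).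

Lemma ev_Xchi a f : ev f (Xchi a) = chi a f.
Proof.
rewrite (lin_expand f (lin_chi a)); apply: eq_bigr => i _; by rewrite mxE.
Qed.

Lemma ev_amul f x y : ev f (amul A x y) = tsumC (fun p q => (ev p x * ev q y : C)) (comul D f).
Proof. by rewrite tsum2_comul_dual. Qed.

Lemma Xchi_mul a c : amul A (Xchi a) (Xchi c) = \sum_d (N a c d)%:R *: Xchi d.
Proof.
apply: ev_inj => f; rewrite ev_amul (lin_sum _ _ _ (lin_ev f)).
transitivity (tsumC (fun x y => (chi a x * chi c y : C)) (comul D f)).
  by etsum2; move=> i j; rewrite !ev_Xchi.
rewrite fusion_chi; apply: eq_bigr => d _; by rewrite (linZ (lin_ev f)) ev_Xchi.
Qed.

Lemma Xchi_free (al be : I -> C) :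
  \sum_d al d *: Xchi d = \sum_d be d *: Xchi d -> al =1 be.
Proof.
move=> H c; have [Eu [E1 E0]] := psi_matrix_units Hrep Hirr Hdist; pose i0 := Ordinal (Hirr c).1.
have coef (g : I -> C) : ev (Eu c i0 i0) (\sum_d g d *: Xchi d) = g c.
  rewrite (lin_sum _ _ _ (lin_ev _)) (bigD1 c) //= big1 => [|d dc].
    rewrite addr0 (linZ (lin_ev _)) ev_Xchi /chi E1 [X in _ *: X](_ : _ = 1) ?[_ *: _]mulr1 //.
    rewrite /mxtrace (bigD1 i0) //= mxE !eqxx big1 ?addr0 // => i ii0.
    by rewrite mxE (negbTE ii0).
  by rewrite (linZ (lin_ev _)) ev_Xchi /chi E0 // mxtrace0 scaler0.
by rewrite -[LHS]coef H coef.
Qed.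

Lemma natr_inj (m p : nat) : m%:R = p%:R :> C -> m = p.
Proof. by move/eqP; rewrite eqr_nat => /eqP. Qed.

Lemma vac_mull e a : b e != 0 -> amul A (Xchi e) (Xchi a) = (e == l a)%:R *: Xchi a.
Proof.
move=> be; rewrite Xchi_mul (bigD1 a) //= big1 ?addr0 => [|c ca].
  by rewrite (proj2 (Hl a)) // eqxx andbT.
by rewrite (proj2 (Hl a)) // [a == c]eq_sym (negbTE ca) andbF scale0r.
Qed.

Lemma vac_mulr e a : b e != 0 -> amul A (Xchi a) (Xchi e) = (e == r a)%:R *: Xchi a.
Proof.
move=> be; rewrite Xchi_mul (bigD1 a) //= big1 ?addr0 => [|c ca].
  by rewrite (proj2 (Hr a)) // eqxx andbT.
by rewrite (proj2 (Hr a)) // [a == c]eq_sym (negbTE ca) andbF scale0r.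
Qed.

(** The vacuum character of l_a fixes X_a, hence X_a X_c, but annihilates every X_d with l_d
    different from l_a. *)
Lemma fusion_l a c d : N a c d != 0 -> l a = l d.
Proof.
move=> N0; have be : b (l a) != 0 by case: (Hl a).
have := amulA HA (Xchi (l a)) (Xchi a) (Xchi c).
rewrite vac_mull // eqxx scale1r Xchi_mul (lin_sum _ _ _ (lin_amulr A _)).
under [in RHS]eq_bigr => x _ do rewrite (linZ (lin_amulr A _)) vac_mull // scalerA.
move/Xchi_free => /(_ d) /esym; case: eqP => // _; rewrite mulr0 => /esym/eqP.
by rewrite pnatr_eq0 (negbTE N0).
Qed.

Lemma fusion_m a c d : N a c d != 0 -> r a = l c.
Proof.
move=> N0; have be : b (r a) != 0 by case: (Hr a).
have := amulA HA (Xchi a) (Xchi (r a)) (Xchi c).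
rewrite vac_mulr // eqxx scale1r (vac_mull c be) (linZ (lin_amulr A _)) Xchi_mul scaler_sumr.
under [in RHS]eq_bigr => x _ do rewrite scalerA.
move/Xchi_free => /(_ d) /esym; case: eqP => // _; rewrite mul0r => /esym/eqP.
by rewrite pnatr_eq0 (negbTE N0).
Qed.

(** In N_{l_e e}^e = 1 both factors are vacua, so the right-hand rule applies as well and forces l_e
    = e. *)
Lemma l_vac e : b e != 0 -> l e = e.
Proof.
move=> be; have [ble /(_ (l e) e)] := Hl e; rewrite !eqxx => /(_ ble) N1.
have := (proj2 (Hr (l e))) e e be; rewrite N1.
by case: (e == r (l e)) => //=; case: eqP.
Qed.

(** * Vacuum components of the counit and slices of Delta(1) *)

Definition epsE a f : C := \tr (b a *m psi a f).

Lemma lin_epsE a : @lin C E C^o (epsE a).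
Proof. by move=> c f g; rewrite /epsE psiL mulmxDr -scalemxAr linearP. Qed.

Lemma eps_sum f : eps D f = \sum_a epsE a f.
Proof. by rewrite eps_dual Hb. Qed.

(** [Ptgt e] and [Qsrc e] turn out to be the central idempotents collecting the blocks with l_a = e
    and r_a = e respectively. *)
Definition Ptgt e : E := sw (fun x y => epsE e x *: y) one.
Notation Qsrc e := (src D (epsE e)).

(** A bilinear expression in the two legs factors through the Kronecker product, so it vanishes
    together with the tensor representation. *)
Lemma tens_rep_contract a c f (M : lmodType C) (G : 'M[C]_(na a) -> 'M[C]_(na c) -> M) :
  (forall Y, lin (fun X => G X Y)) -> (forall X, lin (G X)) ->
  tens_rep A (psi a) (psi c) f = 0 ->
  tsum2 (fun x y => G (psi a x) (psi c y)) (comul D f) = 0.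
Proof.
move=> G1 G2; rewrite tens_repE => T0.
transitivity (tsum2 (fun x y => \sum_p \sum_q \sum_s \sum_t
   (psi a x p q * psi c y s t) *: G (delta_mx p q) (delta_mx s t)) (comul D f)).
  etsum2; move=> i j; rewrite [psi a _ in LHS]matrix_sum_delta (lin_sum _ _ _ (G1 _)).
  apply: eq_bigr => p _; rewrite (lin_sum _ _ _ (G1 _)); apply: eq_bigr => q _.
  rewrite (linZ (G1 _)) [psi c _ in LHS]matrix_sum_delta (lin_sum _ _ _ (G2 _)) scaler_sumr.
  apply: eq_bigr => s _; rewrite (lin_sum _ _ _ (G2 _)) scaler_sumr; apply: eq_bigr => t _.
  by rewrite (linZ (G2 _)) scalerA.
rewrite tsum2_sum; apply: big1 => p _; rewrite tsum2_sum; apply: big1 => q _.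
rewrite tsum2_sum; apply: big1 => s _; rewrite tsum2_sum; apply: big1 => t _.
have := congr1 (fun Y : 'M[C]_(na a * na c) => Y (mxvec_index p s) (mxvec_index q t)) T0.
rewrite (tsum2_comp (M := C^o)
  (f := fun Y : 'M[C]_(na a * na c) => (Y (mxvec_index p s) (mxvec_index q t) : C))); last first.
  by move=> *; rewrite !mxE.
rewrite mxE => /(congr1 (fun z => z *: G (delta_mx p q) (delta_mx s t))).
rewrite scale0r (tsum2_comp (V := C^o) (f := fun z : C => z *: G (delta_mx p q) (delta_mx s t))); last first.
  by move=> *; rewrite scalerDl scalerA.
by move=> <-; etsum2; move=> i j; rewrite kronE.
Qed.

Lemma tens_rep_vacl e a f : b e != 0 -> e != l a -> tens_rep A (psi e) (psi a) f = 0.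
Proof.
move=> be ea; rewrite HVW big1 // => c _; apply: big1 => mu _; exfalso.
by case: mu => m; rewrite (proj2 (Hl a)) // (negbTE ea).
Qed.

Lemma tens_rep_vacr e a f : b e != 0 -> e != r a -> tens_rep A (psi a) (psi e) f = 0.
Proof.
move=> be ea; rewrite HVW big1 // => c _; apply: big1 => mu _; exfalso.
by case: mu => m; rewrite (proj2 (Hr a)) // (negbTE ea).
Qed.

Lemma epsE0 e f : b e = 0 -> epsE e f = 0.
Proof. by move=> be; rewrite /epsE be mul0mx mxtrace0. Qed.

Let lin_psi_tsum a (h : E -> E -> E) X : psi a (tsum2 h X) = tsum2 (fun x y => psi a (h x y)) X.
Proof. exact: (tsum2_comp _ _ (psiL a)). Qed.

Lemma psi_Ptgt0 e a : e != l a -> psi a (Ptgt e) = 0.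
Proof.
move=> ea; rewrite /Ptgt lin_psi_tsum.
transitivity (tsum2 (fun x y => epsE e x *: psi a y) (comul D one)).
  by etsum2; move=> i j; rewrite (linZ (psiL a)).
have [be|be] := eqVneq (b e) 0.
  rewrite -[RHS](scale0r (psi a one)) /tsum2 scale0r big1 // => i _; apply: big1 => j _.
  by rewrite epsE0 // scale0r scaler0.
apply: (tens_rep_contract (G := fun X Y => \tr (b e *m X) *: Y)) (tens_rep_vacl one be ea).
  by move=> Y c X X'; rewrite mulmxDr -scalemxAr linearP scalerDl scalerA.
by move=> X; apply: lin_scaler; exact: lin_id.
Qed.

Lemma sum_Ptgt : \sum_e Ptgt e = one.
Proof.
rewrite -[RHS](sw_counitl HD (g := fun x => x)) // -tsum2_sum.
by etsum2; move=> i j; rewrite eps_sum scaler_suml.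
Qed.

(** The slices sum to 1 by the counit axiom, and on block a all but the one at l_a vanish for lack
    of fusion channels. *)
Lemma psi_Ptgt e a : psi a (Ptgt e) = (e == l a)%:R%:M.
Proof.
have [->|ea] := eqVneq e (l a); last by rewrite psi_Ptgt0 // raddf0.
rewrite -[RHS](psi1 a) -sum_Ptgt [RHS](lin_sum _ _ _ (psiL a)) [RHS](bigD1 (l a)) //=.
by rewrite [X in _ = _ + X]big1 ?addr0 // => e' e'l; exact: psi_Ptgt0.
Qed.

Lemma psi_Qsrc0 e a : e != r a -> psi a (Qsrc e) = 0.
Proof.
move=> ea; rewrite /src lin_psi_tsum.
have [be|be] := eqVneq (b e) 0.
  rewrite /tsum2 big1 // => i _; apply: big1 => j _.
  by rewrite epsE0 // scale0r (lin0 (psiL a)) scaler0.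
transitivity (tsum2 (fun x y => \tr (b e *m psi e y) *: psi a x) (comul D one)).
  by etsum2; move=> i j; rewrite (linZ (psiL a)).
apply: (tens_rep_contract (G := fun X Y => \tr (b e *m Y) *: X)) (tens_rep_vacr one be ea).
  by move=> X; apply: lin_scaler; exact: lin_id.
by move=> Y c X X'; rewrite mulmxDr -scalemxAr linearP scalerDl scalerA.
Qed.

Lemma sum_Qsrc : \sum_e Qsrc e = one.
Proof.
rewrite -[RHS](sw_counitr HD (g := fun x => x)) // -tsum2_sum.
by etsum2; move=> i j; rewrite eps_sum scaler_suml.
Qed.

Lemma psi_Qsrc e a : psi a (Qsrc e) = (e == r a)%:R%:M.
Proof.
have [->|ea] := eqVneq e (r a); last by rewrite psi_Qsrc0 // raddf0.
rewrite -[RHS](psi1 a) -sum_Qsrc [RHS](lin_sum _ _ _ (psiL a)) [RHS](bigD1 (r a)) //=.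
by rewrite [X in _ = _ + X]big1 ?addr0 // => e' e'l; exact: psi_Qsrc0.
Qed.

Lemma block_unit c : exists f, forall a, psi a f = (a == c)%:R%:M.
Proof.
have [e [e1 e0]] := psi_block_unit Hrep Hirr Hdist c.
by exists e => a; have [->|ac] := eqVneq a c; rewrite ?e1 // e0 // raddf0.
Qed.

(** Otherwise the unit f of block r_c would act by zero on the tensor product of [bar c] and [c],
    hence psi_c(S(f_1) f_2) = 0. But S(f_1) f_2 = eps_s(f) is [Qsrc (r c)], which acts on block c as
    the identity. *)
Lemma fusion_bar_neq0 c : N (bar c) c (r c) != 0.
Proof.
apply/eqP => N0; have [f fE] := block_unit (r c).
have T0 : tens_rep A (psi (bar c)) (psi c) f = 0.
  rewrite HVW big1 // => d _; apply: big1 => mu _; rewrite fE.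
  have [dr|_] := eqVneq d (r c); last by rewrite raddf0 mulmx0 mul0mx.
  by exfalso; case: mu; rewrite dr N0.
have : psi c (eps_s D f) = 0.
  rewrite /eps_s lin_psi_tsum.
  transitivity (tsum2 (fun x y => (Z c *m psi (bar c) x *m Zi c)^T *m psi c y) (comul D f)).
    by etsum2; move=> i j; rewrite psiM psiS.
  apply: (tens_rep_contract (G := fun X Y => (Z c *m X *m Zi c)^T *m Y)) T0.
    by move=> Y t X X'; rewrite mulmxDr mulmxDl -scalemxAr -scalemxAl linearP mulmxDl -scalemxAl.
  by move=> X t Y Y'; rewrite mulmxDr -scalemxAr.
have -> : eps_s D f = Qsrc (r c).
  rewrite (eps_sE HD) /src; etsum2; move=> i j; congr (_ *: _).
  rewrite eps_sum (bigD1 (r c)) //= big1 ?addr0 => [|d dr].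
    by rewrite /epsE psiM fE eqxx mul1mx.
  by rewrite /epsE psiM fE (negbTE dr) raddf0 mul0mx mulmx0 mxtrace0.
rewrite psi_Qsrc eqxx => /eqP; rewrite -mxrank_eq0 mxrank1.
by have := (Hirr c).1; case: (na c).
Qed.

Lemma l_bar c : l (bar c) = r c.
Proof. by rewrite (fusion_l (fusion_bar_neq0 c)) l_vac //; case: (Hr c). Qed.

Lemma r_bar c : r (bar c) = l c.
Proof. by rewrite -l_bar barK. Qed.

(** * Quantum dimensions and reciprocity *)

Variables (w : I -> C) (theta : forall c, 'cV[C]_(na (bar c) * na c)).
Hypothesis Hw0 : forall c, w c != 0.
Hypothesis Htheta : forall c (phi : 'rV[C]_(na (bar c))),
  (phi *m vec_mx (theta c)^T)^T
    = castmx (f_equal na (barK c), erefl 1%N) (Zi (bar c) *m phi^T).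
Hypothesis Hw : forall c (mu : 'I_(N (bar c) c (r c))),
  theta c *m mxvec (Z c)^T
    = w c *: ((V (bar c) c (r c) mu *m v (r c)) *m (u (r c) *m W (bar c) c (r c) mu)).
Variable d : I -> C.
Hypothesis Hd : forall a, d a ^+ 2 = w a * w (bar a) /\ d a = d (bar a).
Variable g : E.
Hypothesis Hg : forall a, psi a g = (d a / w (bar a)) *:
  ((Zi a)^T *m castmx (erefl (na (bar a)), f_equal na (barK a)) (Z (bar a))).
Variables k ki : E.
Hypothesis Hsph0 : forall e, b e != 0 -> (u e *m v e) 0 0 != 0.
Hypothesis Hpiv : pivotal A k ki.
Hypothesis Hsph : forall a, \tr (psi a k) / (u (l a) *m v (l a)) 0 0
                    = \tr (psi a ki) / (u (r a) *m v (r a)) 0 0.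
Variable xi : I -> C.
Hypothesis Hxi : forall a, psi a k = xi a *: psi a g.

Notation uv e := ((u e *m v e) 0 0).
Notation ZB a := (castmx (erefl (na (bar a)), f_equal na (barK a)) (Z (bar a))).
Notation ZiB a := (castmx (f_equal na (barK a), erefl (na (bar a))) (Zi (bar a))).

Let d_neq0 a : d a != 0.
Proof. by rewrite -sqrf_eq0 (proj1 (Hd a)) mulf_neq0. Qed.

Let uvl a : uv (l a) != 0. Proof. by apply: Hsph0; case: (Hl a). Qed.
Let uvr a : uv (r a) != 0. Proof. by apply: Hsph0; case: (Hr a). Qed.

Lemma kki : mul k ki = one. Proof. by rewrite amul_dual; case: Hpiv. Qed.
Lemma kik : mul ki k = one. Proof. by rewrite amul_dual; case: Hpiv. Qed.
Lemma kgl : comul D k = tmul2 D (t2 k k) (comul D one).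
Proof. by rewrite !comul_dual -dtmul_dual; case: Hpiv. Qed.
Lemma kgr : comul D k = tmul2 D (comul D one) (t2 k k).
Proof. by rewrite !comul_dual -dtmul_dual; case: Hpiv. Qed.
Lemma kS2 f : S (S f) = mul (mul k f) ki.
Proof. by rewrite !antip_dual !amul_dual; case: Hpiv. Qed.

Let Sk : S k = ki := antip_glike HD dual_antipM kki kik kgl kgr.
Let Ski : S ki = k. Proof. by rewrite -Sk kS2 (amulA HD) kki (amul1r HD). Qed.

Lemma theta_trmx c : (vec_mx (theta c)^T)^T = ZiB c.
Proof.
have H (p : 'cV[C]_(na (bar c))) : (vec_mx (theta c)^T)^T *m p = ZiB c *m p.
  rewrite -[p in LHS]trmxK -trmx_mul Htheta trmxK.
  by move: (f_equal na (barK c)) (Zi (bar c)) => e; case: _ / e => X; rewrite !castmx_id.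
apply/matrixP => i j; have /colP /(_ i) := H (delta_mx j 0).
by rewrite -!colE !mxE.
Qed.

(** The trace of the identity defining w_c: on one side zeta_c evaluated at theta_c, on the other u
    W V v = u v. *)
Lemma trace_Z_w c : \tr (Z c *m (ZiB c)^T) = w c * uv (r c).
Proof.
pose mu : 'I_(N (bar c) c (r c)) := Ordinal (etrans (lt0n _) (fusion_bar_neq0 c)).
have := congr1 mxtrace (Hw mu); rewrite linearZ /= mxtrace_mulC [\tr (V _ _ _ _ *m _ *m _)]mxtrace_mulC.
rewrite -!mulmxA [W _ _ _ _ *m _]mulmxA HWV1 eqxx mul1mx.
have -> : \tr (u (r c) *m v (r c)) = uv (r c) by rewrite /mxtrace big_ord1.
move=> <-; rewrite -theta_trmx trmxK /mxtrace big_ord1 mxE sum_mxvec_index exchange_big /=.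
apply: eq_bigr => i _; rewrite mxE; apply: eq_bigr => j _.
by rewrite mxvecE !mxE.
Qed.

Let xi_neq0 a : xi a != 0.
Proof.
apply/eqP => x0; have := congr1 (psi a) kki; rewrite psiM Hxi x0 scale0r mul0mx psi1.
move/esym/eqP; rewrite -mxrank_eq0 mxrank1.
by have := (Hirr a).1; case: (na a).
Qed.

(** Inverting the formula for psi_a(k) gives a coefficient w_{bar a} / (xi_a d_a), the trace
    contributes w_a, and w_a w_{bar a} = d_a^2. *)
Lemma chi_ki a : chi a ki = d a / xi a * uv (r a).
Proof.
have w0 := Hw0 (bar a).
have kE : psi a k = (xi a * (d a / w (bar a))) *: ((Zi a)^T *m ZB a).
  by rewrite Hxi Hg scalerA.
pose Y := (xi a * (d a / w (bar a)))^-1 *: (ZiB a *m (Z a)^T).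
have c0 : xi a * (d a / w (bar a)) != 0 by rewrite !mulf_neq0 ?invr_eq0.
have kY : psi a k *m Y = 1%:M.
  rewrite kE /Y -scalemxAr -scalemxAl scalerA mulVf // scale1r.
  rewrite -mulmxA (mulmxA (ZB a)) castmx_mul (proj1 (HZ (bar a))) mul1mx -trmx_mul.
  by rewrite (proj1 (HZ a)) trmx1.
rewrite /chi; have -> : psi a ki = Y by rewrite -[LHS]mulmx1 -kY mulmxA -psiM kik psi1 mul1mx.
rewrite /Y linearZ /= -mxtrace_tr trmx_mul trmxK trace_Z_w.
have := proj1 (Hd a); rewrite expr2 => dd.
rewrite !invfM invrK mulrA; congr (_ * _).
rewrite -!mulrA -[w (bar a) * w a]mulrC -dd; field.
by rewrite d_neq0 xi_neq0.
Qed.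

(** Stated for a variable [x], so that substitution removes the casts; it is applied with
    [bar (bar a)] for [x]. *)
Let trace_castmx x a (e : x = a) (e' : bar x = bar a) (Y : 'M[C]_(na (bar a), na x)) :
  \tr (castmx (erefl (na (bar a)), f_equal na e) Y *m (Zi a)^T)
  = \tr (Y *m (castmx (f_equal na e', erefl (na x)) (Zi x))^T).
Proof. by subst x; rewrite !castmx_id. Qed.

Lemma chi_k a : chi a k = xi a * d a * uv (l a).
Proof.
rewrite /chi Hxi Hg scalerA linearZ /= mxtrace_mulC (trace_castmx _ (barK (bar a))).
rewrite trace_Z_w r_bar mulrA; congr (_ * _).
by rewrite -!mulrA mulVf ?mulr1.
Qed.

Definition qdim a : C := chi a k / uv (l a).

Lemma qdimE a : qdim a = xi a * d a.
Proof. by rewrite /qdim chi_k mulfK. Qed.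

(** Sphericality replaces the left-normalised trace of k by the right-normalised trace of k^-1. *)
Lemma qdimEV a : qdim a = d a / xi a.
Proof. by rewrite /qdim /chi Hsph -/(chi a ki) chi_ki mulfK. Qed.

Lemma chi_ki_qdim a : chi a ki = qdim a * uv (r a).
Proof. by rewrite qdimEV chi_ki. Qed.

Lemma qdim_sqr a : qdim a ^+ 2 = d a ^+ 2.
Proof. by rewrite expr2 {1}qdimE qdimEV; field. Qed.

Lemma qdim_neq0 a : qdim a != 0.
Proof. by rewrite qdimE mulf_neq0. Qed.

(** S exchanges k with k^-1 and conjugation exchanges l with r, so this compares the two normalised
    traces. *)
Lemma qdim_bar a : qdim (bar a) = qdim a.
Proof. by rewrite {1}/qdim -chi_antip Sk l_bar chi_ki_qdim mulfK. Qed.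

Lemma matrix_units_expand (Eu : forall a, 'I_(na a) -> 'I_(na a) -> E) :
  (forall a i j, psi a (Eu a i j) = delta_mx i j) ->
  (forall a c i j, c != a -> psi c (Eu a i j) = 0) ->
  forall x, x = \sum_a \sum_i \sum_j psi a x i j *: Eu a i j.
Proof.
move=> E1 E0 x.
apply: psi_ext => c; rewrite (lin_sum _ _ _ (psiL c)) (bigD1 c) //= [X in _ = _ + X]big1 ?addr0 => [|a ac].
  rewrite [LHS]matrix_sum_delta (lin_sum _ _ _ (psiL c)); apply: eq_bigr => i _.
  rewrite (lin_sum _ _ _ (psiL c)); apply: eq_bigr => j _.
  by rewrite (linZ (psiL c)) E1.
rewrite (lin_sum _ _ _ (psiL c)) big1 // => i _; rewrite (lin_sum _ _ _ (psiL c)) big1 // => j _.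
by rewrite (linZ (psiL c)) E0 ?scaler0 // eq_sym.
Qed.

(** The operator is left multiplication by f k and right multiplication by k^-1; on each matrix
    block such an operator has the product of the two traces as its trace. *)
Lemma trS2_chi f : trS2 D f = \sum_a chi a (mul f k) * chi a ki.
Proof.
have [Eu [E1 E0]] := psi_matrix_units Hrep Hirr Hdist.
have dec := matrix_units_expand E1 E0.
pose M x := mul (mul f k) (mul x ki).
have ML : lin M by rewrite /M; slin.
have -> : trS2 D f = \sum_t (M (bvec t)) 0 t.
  by apply: eq_bigr => t _; rewrite /M kS2 !(amulA HD).
transitivity (\sum_t \sum_a \sum_i \sum_j psi a (bvec t) i j * (M (Eu a i j)) 0 t).
  apply: eq_bigr => t _; rewrite {1}[bvec t]dec (lin_sum _ _ _ ML) summxE.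
  apply: eq_bigr => a _; rewrite (lin_sum _ _ _ ML) summxE; apply: eq_bigr => i _.
  rewrite (lin_sum _ _ _ ML) summxE; apply: eq_bigr => j _.
  by rewrite (linZ ML) mxE.
rewrite exchange_big; apply: eq_bigr => a _ /=.
rewrite exchange_big /chi {1}/mxtrace mulr_suml; apply: eq_bigr => i _ /=.
rewrite exchange_big /mxtrace mulr_sumr; apply: eq_bigr => j _ /=.
transitivity (psi a (M (Eu a i j)) i j).
  rewrite (lin_expand (M _) (psiL a)) summxE; apply: eq_bigr => t _.
  by rewrite mxE mulrC.
rewrite /M psiM [psi a (mul (Eu _ _ _) _)]psiM E1 mulmxA.
rewrite (_ : psi a (mul f k) *m delta_mx i j *m psi a ki = col i (psi a (mul f k)) *m row j (psi a ki)).
  by rewrite mxE big_ord1 !mxE.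
by rewrite colE rowE mulmxA -(mulmxA _ (delta_mx i 0)) mul_delta_mx.
Qed.

Lemma trS2_pull_chi f h :
  sw (fun x y => trS2 D (mul f y) *: x) h = sw (fun x y => trS2 D (mul y h) *: S x) f.
Proof. exact: (trS2_pull HD dual_antipM kki kik kgl kgr kS2). Qed.

(** Apply chi_x to the trace identity at k^-1 times the units of blocks c and e. Each k^-1 cancels
    the k in [trS2_chi], and both sides become a multiplicity times the nonzero number chi_c(k^-1)
    chi_e(k^-1). *)
Lemma fusion_frobenius x c e : N x c e = N (bar x) e c.
Proof.
have [pc pcE] := block_unit c; have [pe peE] := block_unit e.
have ga a : chi a ki != 0 by rewrite chi_ki_qdim mulf_neq0 ?qdim_neq0.
have chi_pi a y p (pE : forall a', psi a' p = (a' == a)%:R%:M) a' :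
    chi a' (mul p y) = (a' == a)%:R * chi a' y.
  by rewrite /chi psiM pE mul_scalar_mx linearZ.
have tl y : trS2 D (mul (mul ki pc) y) = chi c ki * chi c y.
  rewrite trS2_chi (bigD1 c) //= big1 ?addr0 => [|a ac].
    rewrite chiC -!(amulA HD) kki (amul1l HD) (chi_pi c) // eqxx mul1r; exact: mulrC.
  by rewrite chiC -!(amulA HD) kki (amul1l HD) (chi_pi c) // (negbTE ac) !mul0r.
have tr' y : trS2 D (mul y (mul ki pe)) = chi e ki * chi e y.
  rewrite trS2_chi.
  have E a : chi a (mul (mul y (mul ki pe)) k) = (a == e)%:R * chi a y.
    by rewrite chiC /chi !psiM peE mul_mx_scalar -!scalemxAr mxtraceZ mxtrace_mulC -mulmxA -psiM kik psi1 mulmx1.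
  rewrite (bigD1 e) //= big1 ?addr0 => [|a ac]; rewrite E; last by rewrite (negbTE ac) !mul0r.
  by rewrite eqxx mul1r mulrC.
have kp a p : chi a (mul ki p) = chi a (mul p ki) by rewrite chiC.
have H := congr1 (chi x) (trS2_pull_chi (mul ki pc) (mul ki pe)).
rewrite !(tsum2_comp _ _ (lin_chi x)) in H.
have {}H : chi c ki * tsumC (fun y z => (chi x y * chi c z : C)) (comul D (mul ki pe))
  = chi e ki * tsumC (fun y z => (chi (bar x) y * chi e z : C)) (comul D (mul ki pc)).
  rewrite !tsum2_scale.
  transitivity (tsumC (fun y z => chi x (trS2 D (mul (mul ki pc) z) *: y)) (comul D (mul ki pe))).
    etsum2; move=> i j; rewrite (linZ (lin_chi x)) tl.
    by rewrite [RHS]mulrAC -mulrA.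
  rewrite H; etsum2; move=> i j; rewrite (linZ (lin_chi x)) chi_antip tr'.
  by rewrite [LHS]mulrAC -mulrA.
move: H; rewrite !fusion_chi.
have sumN a y p q (pE : forall a', psi a' p = (a' == q)%:R%:M) :
    \sum_z (N a y z)%:R * chi z (mul ki p) = (N a y q)%:R * chi q ki.
  rewrite (bigD1 q) //= big1 ?addr0 => [|z zq]; rewrite kp (chi_pi q) //.
    by rewrite eqxx mul1r.
  by rewrite (negbTE zq) mul0r mulr0.
rewrite (sumN _ _ _ e) // (sumN _ _ _ c) // mulrCA [RHS]mulrCA [chi e ki * _]mulrC.
by move/(mulIf (mulf_neq0 (ga c) (ga e)))/natr_inj.
Qed.

Lemma epsE_scalar e f s : b e != 0 -> psi e f = s%:M -> epsE e f = s * uv e.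
Proof.
move=> be fs; rewrite /epsE fs mul_mx_scalar mxtraceZ (Hvu be) mxtrace_mulC.
by rewrite /mxtrace big_ord1.
Qed.

(** The partial quantum trace y of Delta(1) over c is central, so it acts on each block by a scalar.
    Computing that scalar at a evaluates chi_a(k y), the fusion sum of the traces of k. *)
Lemma qdimM a c : \sum_e (N a c e)%:R * qdim e = (r a == l c)%:R * (qdim a * qdim c).
Proof.
pose y := src D (fun q => chi c (mul k q)).
have chikL : @lin C E C^o (fun q => chi c (mul k q)) by have := lin_chi c => ?; slin.
have ycent f : mul y f = mul f y.
  exact: (src_pivotal_central HD dual_antipM kik kS2 f (lin_chi c) (chiC c)).
have [s ys] : exists s : I -> C, forall e, psi e y = (s e)%:M.
  exists (fun e => psi e y (Ordinal (Hirr e).1) (Ordinal (Hirr e).1)) => e.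
  apply: scalar_of_central => Y; have [f <-] := irr_onto (Hrep e) (Hirr e) Y.
  by rewrite -!psiM ycent.
(* y is a source element fixed by eps_s, hence a combination of the [Qsrc], of which block e sees
   only the one at r_e. *)
have s_r e : s e = s (r e).
  have := congr1 (psi e) (eps_s_src HD chikL); rewrite -/y lin_psi_tsum.
  have -> : tsum2 (fun p q => psi e (eps D (mul y q) *: p)) (comul D one)
     = \sum_e' s e' *: psi e (Qsrc e').
    transitivity (tsum2 (fun p q => \sum_e' (s e' * epsE e' q) *: psi e p) (comul D one)).
      etsum2; move=> i j; rewrite (linZ (psiL e)) eps_sum scaler_suml.
      by apply: eq_bigr => e' _; rewrite /epsE psiM ys mul_scalar_mx -scalemxAr linearZ.
    rewrite tsum2_sum; apply: eq_bigr => e' _; rewrite lin_psi_tsum.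
    rewrite (tsum2_comp (f := fun X => s e' *: X)); last by apply: lin_scaler; exact: lin_id.
    by etsum2; move=> i j; rewrite (linZ (psiL e)) scalerA.
  rewrite (bigD1 (r e)) //= big1 ?addr0 => [|e' e'r]; rewrite psi_Qsrc.
    rewrite eqxx scalemx1 ys => /matrixP /(_ (Ordinal (Hirr e).1) (Ordinal (Hirr e).1)).
    by rewrite !mxE eqxx !mulr1n => ->.
  by rewrite (negbTE e'r) raddf0 scaler0.
(* On a vacuum block the scalar is found by slicing the other leg of Delta(1) with the counit, which
   produces [Ptgt e]. *)
have s_vac e : b e != 0 -> s e * uv e = (e == l c)%:R * chi c k.
  move=> be; rewrite -(epsE_scalar be (ys e)) /y /src.
  rewrite (tsum2_comp (M := C^o) _ _ (lin_epsE e)).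
  transitivity (chi c (mul k (Ptgt e))).
    have cL := lin_chi c.
    rewrite /Ptgt (tsum2_comp (M := C^o) (f := fun z => chi c (mul k z))); last by slin.
    etsum2; move=> i j; rewrite (linZ (lin_epsE e)).
    rewrite (linZ (f := fun z => chi c (mul k z) : C^o)); last by slin.
    exact: mulrC.
  by rewrite /chi psiM psi_Ptgt mul_mx_scalar mxtraceZ.
have sE : s a = (r a == l c)%:R * qdim c.
  have br : b (r a) != 0 by case: (Hr a).
  apply: (mulIf (uvr a)); rewrite s_r s_vac // /qdim.
  by case: eqP => [->|_]; rewrite ?mul0r // !mul1r mulfVK.
have H : \sum_e (N a c e)%:R * chi e k = s a * chi a k.
  rewrite -fusion_chi -{1}[k](amul1r HD).
  have [aL cL] := (lin_chi a, lin_chi c).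
  rewrite (sw_glikel (V := C^o) HD kgl (h := fun x z => (chi a x * chi c z : C))); last by slin.
  have -> : s a * chi a k = chi a (mul k y).
    by rewrite /chi psiM ys mul_mx_scalar mxtraceZ.
  rewrite /y /src (tsum2_comp (M := C^o) (f := fun z => chi a (mul k z))); last by slin.
  etsum2; move=> i j; rewrite (linZ (f := fun z => chi a (mul k z) : C^o)); last by slin.
  by rewrite mulrC.
apply: (mulIf (uvl a)); rewrite mulr_suml.
transitivity (\sum_e (N a c e)%:R * chi e k).
  apply: eq_bigr => e _; rewrite -mulrA; have [->|Nn0] := eqVneq (N a c e) 0%N; first by rewrite !mul0r.
  by rewrite (fusion_l Nn0) /qdim mulfVK.
rewrite H sE mulrAC; have {1}-> : chi a k = qdim a * uv (l a) by rewrite /qdim mulfVK.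
ring.
Qed.

Notation Delta := (gdim l qdim).

Lemma gdim_d e : \sum_(x | l x == e) d x ^+ 2 = Delta e.
Proof. by apply: eq_bigr => x _; rewrite qdim_sqr. Qed.

Let Delta_neq0 a : Delta (l a) != 0 :=
  gdim_neq0 barK l_bar fusion_frobenius qdimM qdim_bar qdim_neq0 a.
Let Delta_lr a : Delta (r a) = Delta (l a) :=
  gdim_lr barK l_bar fusion_frobenius qdimM qdim_bar qdim_neq0 a.

(** * Omega and the pulling-through map *)

Variable Om : E.
Hypothesis HOm : forall f, ev f Om = \sum_a ((\sum_(x | l x == l a) d x ^+ 2)^-1
                                     * (d a / xi a) * \tr (psi a f)).

Definition wt a : C := qdim a / Delta (l a).

Lemma ev_Om f : ev f Om = \sum_a wt a * chi a f.
Proof.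
by rewrite HOm; apply: eq_bigr => a _; rewrite gdim_d -qdimEV /wt [_^-1 * _]mulrC.
Qed.

Lemma wt_neq0 a : wt a != 0.
Proof. by rewrite mulf_neq0 ?invr_eq0 ?qdim_neq0 ?Delta_neq0. Qed.

Lemma ev_OmC f h : ev (mul f h) Om = ev (mul h f) Om.
Proof. by rewrite !ev_Om; apply: eq_bigr => a _; rewrite chiC. Qed.

Lemma antip_Om : antip A Om = Om.
Proof.
apply: ev_inj => f; rewrite -ev_antip_dual !ev_Om.
rewrite (reindex_inj (can_inj barK)) /=; apply: eq_bigr => a _.
by rewrite chi_antip barK /wt qdim_bar l_bar Delta_lr.
Qed.

Lemma comul_OmE i j : comul A Om i j = ev (mul (bvec i) (bvec j)) Om.
Proof.
rewrite ev_amul_dual -{1}[comul A Om]tsum2_t2id tsum2E.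
by etsum2; move=> p q; rewrite t2E !ev_bvecl.
Qed.

Lemma Om_cocommutative : elt_cocommutative A Om.
Proof. by apply/matrixP => i j; rewrite mxE !comul_OmE ev_OmC. Qed.

Lemma Om_XchiE : Om = \sum_a wt a *: Xchi a.
Proof.
apply: ev_inj => f; rewrite ev_Om (lin_sum _ _ _ (lin_ev f)).
by apply: eq_bigr => a _; rewrite (linZ (lin_ev f)) ev_Xchi.
Qed.

Lemma Om_idempotent : amul A Om Om = Om.
Proof.
rewrite {2 3}Om_XchiE {1}Om_XchiE (lin_sum _ _ _ (lin_amull A _)).
transitivity (\sum_a \sum_c \sum_e (wt a * wt c * (N a c e)%:R) *: Xchi e).
  apply: eq_bigr => a _; rewrite (lin_sum _ _ _ (lin_amulr A _)); apply: eq_bigr => c _.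
  rewrite (linZ (lin_amull A _)) (linZ (lin_amulr A _)) Xchi_mul scalerA scaler_sumr.
  by apply: eq_bigr => e _; rewrite scalerA.
transitivity (\sum_e \sum_a \sum_c (wt a * wt c * (N a c e)%:R) *: Xchi e).
  by under eq_bigr => a _ do rewrite exchange_big /=; rewrite exchange_big.
apply: eq_bigr => e _.
have <- : \sum_a \sum_c wt a * wt c * (N a c e)%:R = wt e.
  exact: (fusion_idempotent barK fusion_l fusion_m l_bar fusion_frobenius qdimM qdim_bar qdim_neq0).
by rewrite scaler_suml; apply: eq_bigr => a _; rewrite scaler_suml.
Qed.

(** On every block the form (f, h) -> Omega(f h) is a nonzero multiple of the trace form. *)
Lemma Om_nondegenerate_dual (y : E) : exists f, forall h, ev (mul f h) Om = ev h y.
Proof.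
have [Eu [E1 E0]] := psi_matrix_units Hrep Hirr Hdist.
have dec := matrix_units_expand E1 E0.
(* The indices are swapped because the trace form pairs a matrix unit with its transpose. *)
pose Y a : 'M[C]_(na a) := \matrix_(i, j) ev (Eu a j i) y.
pose f := \sum_a \sum_i \sum_j ((wt a)^-1 * Y a i j) *: Eu a i j.
have fE a : psi a f = (wt a)^-1 *: Y a.
  rewrite /f (lin_sum _ _ _ (psiL a)) (bigD1 a) //= [X in _ + X]big1 ?addr0 => [|a' aa'].
    rewrite [Y a in RHS]matrix_sum_delta scaler_sumr (lin_sum _ _ _ (psiL a)); apply: eq_bigr => i _.
    rewrite scaler_sumr (lin_sum _ _ _ (psiL a)); apply: eq_bigr => j _.
    by rewrite (linZ (psiL a)) E1 scalerA.
  rewrite (lin_sum _ _ _ (psiL a)) big1 // => i _; rewrite (lin_sum _ _ _ (psiL a)) big1 // => j _.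
  by rewrite (linZ (psiL a)) E0 ?scaler0 // eq_sym.
exists f => h; rewrite ev_Om [h in RHS]dec (lin_sum _ _ _ (lin_evl y)); apply: eq_bigr => a _.
rewrite /chi psiM fE -scalemxAl mxtraceZ mulrA mulfV ?wt_neq0 // mul1r mxtrace_mulC.
rewrite (lin_sum _ _ _ (lin_evl y)); apply: eq_bigr => i _.
rewrite mxE (lin_sum _ _ _ (lin_evl y)); apply: eq_bigr => j _.
by rewrite (linZ (lin_evl y)) [Y a _ _]mxE.
Qed.

Lemma Om_nondegenerate : elt_nondegenerate A Om.
Proof.
split=> y; have [f Hf] := Om_nondegenerate_dual y; exists f; apply: ev_inj => h; rewrite -Hf.
  rewrite ev_tsum2r ev_amul_dual; etsum2; move=> i j.
  by rewrite (linZ (lin_ev h)).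
rewrite ev_OmC ev_tsum2r ev_amul_dual; etsum2; move=> i j.
by rewrite (linZ (lin_ev h)) mulrC.
Qed.

(* Multiplying by z and k^-1 turns the integral trS2 into Om, and z only affects
   the second tensor factor of a coproduct. *)
Definition zsrc : E := src D (fun f => \sum_e (Delta e * uv e)^-1 * epsE e f).

Let zphiL : @lin C E C^o (fun f => \sum_e (Delta e * uv e)^-1 * epsE e f).
Proof. by apply: lin_bigsum => e; apply: lin_mulsr; exact: lin_epsE. Qed.

Lemma psi_zsrc a : psi a zsrc = ((Delta (r a) * uv (r a))^-1)%:M.
Proof.
have -> : zsrc = \sum_e (Delta e * uv e)^-1 *: Qsrc e.
  rewrite /zsrc /src.
  transitivity (tsum2 (fun x y => \sum_e ((Delta e * uv e)^-1 * epsE e y) *: x) (comul D one)).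
    by etsum2; move=> i j; rewrite scaler_suml.
  rewrite tsum2_sum; apply: eq_bigr => e _.
  rewrite (tsum2_comp (f := fun X => (Delta e * uv e)^-1 *: X)); last by apply: lin_scaler; exact: lin_id.
  by etsum2; move=> i j; rewrite scalerA.
rewrite (lin_sum _ _ _ (psiL a)) (bigD1 (r a)) //= [X in _ + X]big1 ?addr0 => [|e er].
  by rewrite (linZ (psiL a)) psi_Qsrc eqxx scalemx1.
by rewrite (linZ (psiL a)) psi_Qsrc (negbTE er) raddf0 scaler0.
Qed.

(** The constants in [zsrc] are fixed by this identity: they cancel uv(r_a) in chi_a(k^-1) and
    supply the normalisation at r_a, which equals that at l_a. *)
Lemma trS2_zsrc f : trS2 D (mul zsrc (mul ki f)) = ev f Om.
Proof.
rewrite trS2_chi ev_Om; apply: eq_bigr => a _.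
rewrite chiC /chi !psiM psi_zsrc mul_scalar_mx -scalemxAr mxtraceZ mulmxA -psiM kki psi1 mul1mx.
rewrite -/(chi a ki) -/(chi a f) chi_ki_qdim /wt Delta_lr; field.
by rewrite Delta_neq0 uvr.
Qed.

(** Replace f by z k^-1 f in the trace identity. In the coproduct z reaches only the second leg,
    while k^-1 reaches both and S(k^-1 f_1) = S(f_1) k. *)
Lemma Om_pull f h :
  sw (fun x y => ev (mul f y) Om *: x) h = sw (fun x y => ev (mul y h) Om *: mul (S x) k) f.
Proof.
transitivity (sw (fun x y => trS2 D (mul (mul zsrc (mul ki f)) y) *: x) h).
  by etsum2; move=> i j; rewrite -trS2_zsrc !(amulA HD).
rewrite trS2_pull_chi; have tL := lin_trS2 D.
rewrite (sw_src_mul HD zphiL); last by slin.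
rewrite (sw_glikeVl HD kki kik kgl); last by slin.
etsum2; move=> i j; rewrite dual_antipM Ski; congr (_ *: _).
by rewrite -trS2_zsrc !(amulA HD).
Qed.

(** The transpose of f -> S(f) k under the pairing [ev]. *)
Definition Tpull : 'M[C]_n := \matrix_(i, j) mul (S (bvec j)) k 0 i.

Lemma ev_Tpull f x : ev f (x *m Tpull) = ev (mul (S f) k) x.
Proof.
rewrite [RHS](lin_expand f (f := fun f => ev (mul (S f) k) x : C^o)); last by slin.
apply: eq_bigr => j _; congr (_ * _); rewrite mxE /ev; apply: eq_bigr => i _.
by rewrite mxE mulrC.
Qed.

Lemma tensor_ext (X Y : 'M[C]_n) :
  (forall f h, tsumC (fun x y => (ev f x * ev h y : C)) X = tsumC (fun x y => (ev f x * ev h y : C)) Y) -> X = Y.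
Proof.
move=> H; apply/matrixP => i j; rewrite -[X]tsum2_t2id -[Y]tsum2_t2id !tsum2E.
have := H (bvec i) (bvec j); congr (_ = _); etsum2; move=> p q; by rewrite t2E !ev_bvecl.
Qed.

Lemma Tpull_pull x : tmul2 A (t2 (wone A) x) (comul A Om)
  = tmul2 A (t2 (x *m Tpull) (wone A)) (comul A Om).
Proof.
apply: tensor_ext => f h.
rewrite !(tsum2_tmul2 A (V := C^o)); try slin.
rewrite !(tsum2_t2 (V := C^o)); try slin.
transitivity (ev (sw (fun p q => ev (mul f q) Om *: p) h) x).
  rewrite ev_tsum2l.
  transitivity (tsumC (fun a c => tsumC (fun p q => (ev f a * (ev p x * ev q c) : C)) (comul D h)) (comul A Om)).
    by etsum2; move=> i j; rewrite (amul1l HA) -tsum2_scale tsum2_comul_dual.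
  rewrite exchange_tsum2; etsum2; move=> p q.
  rewrite (linZ (lin_evl x)) ev_amul_dual [RHS]tsum2_scaler; etsum2; move=> i j; ring.
rewrite Om_pull ev_tsum2l.
transitivity (tsumC (fun a c => tsumC (fun p q => (ev p (x *m Tpull) * ev q a * ev h c : C)) (comul D f)) (comul A Om)).
  rewrite exchange_tsum2; etsum2; move=> p q.
  rewrite (linZ (lin_evl x)) ev_amul_dual -ev_Tpull [LHS]tsum2_scaler; etsum2; move=> i j; ring.
etsum2; move=> i j; rewrite (amul1l HA) -tsum2_comul_dual tsum2_scaler.
by etsum2.
Qed.

(** Transposed, this is S(f h) k = (S(h) k) k^-1 (S(f) k), which explains both the reversed legs and
    the middle factor k^-1. *)
Lemma Tpull_comul x : comul A (x *m Tpull)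
  = tsum3 (fun p q s => ev ki q *: t2 (s *m Tpull) (p *m Tpull)) (comul2 A x).
Proof.
apply: tensor_ext => f h; rewrite -ev_amul_dual ev_Tpull tsum3_comul2.
rewrite (tsum2_comp _ _ (@lin_tsum2 _ _ C^o _)).
have -> : mul (S (mul f h)) k = mul (mul (mul (S h) k) ki) (mul (S f) k).
  by rewrite dual_antipM !(amulA HD) -(amulA HD k ki) kki (amul1l HD).
rewrite ev_amul_dual; etsum2; move=> i j.
rewrite (tsum2_comp _ _ (@lin_tsum2 _ _ C^o _)) ev_amul_dual tsum2_scaler; etsum2; move=> p q.
rewrite (linZ (@lin_tsum2 _ _ C^o _)) (tsum2_t2 (V := C^o)); last by slin.
rewrite !ev_Tpull [RHS]mulrCA; ring.
Qed.

Lemma Tpull_Om : tsum2 (fun p q => ev ki q *: (p *m Tpull)) (comul A Om) = antip A Om.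
Proof.
apply: ev_inj => f; rewrite ev_tsum2r -ev_antip_dual.
rewrite -[S f](amul1r HD) -kki -(amulA HD) ev_amul_dual; etsum2; move=> i j.
by rewrite (linZ (lin_ev f)) ev_Tpull mulrC.
Qed.

Theorem spherical_Omega :
  [/\ elt_nondegenerate A Om, elt_cocommutative A Om, amul A Om Om = Om &
      exists T : 'M[C]_n,
        [/\ forall x, tmul2 A (t2 (wone A) x) (comul A Om)
                      = tmul2 A (t2 (x *m T) (wone A)) (comul A Om),
            forall x, comul A (x *m T)
                      = tsum3 (fun p q s => ev ki q *: t2 (s *m T) (p *m T)) (comul2 A x),
            tsum2 (fun p q => ev ki q *: (p *m T)) (comul A Om) = antip A Om &
            antip A Om = Om]].
Proof.
split; [exact: Om_nondegenerate|exact: Om_cocommutative|exact: Om_idempotent|].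
exists Tpull; split; [exact: Tpull_pull|exact: Tpull_comul|exact: Tpull_Om|exact: antip_Om].
Qed.

End Spherical.

Unset Implicit Arguments.
Set Strict Implicit.
Set Printing Implicit Defensive.

Theorem theorem5p15
  (n : nat) (A : wha Cplx n) (HA : is_weak_hopf A) (Hss : dual_semisimple A)
  (* a complete family of pairwise non-isomorphic irreps of A^* *)
  (I : finType) (na : I -> nat) (psi : forall a : I, 'rV[Cplx]_n -> 'M[Cplx]_(na a))
  (Hrep : forall a, is_alg_rep A (psi a))
  (Hirr : forall a, irreducible_rep (psi a))
  (Hdist : forall a b, rep_iso (psi a) (psi b) -> a = b)
  (Hcompl : forall m (rho : 'rV[Cplx]_n -> 'M[Cplx]_m),
      is_alg_rep A rho -> irreducible_rep rho -> exists a, rep_iso rho (psi a))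
  (* vacuum *)
  (b : forall a, 'M[Cplx]_(na a))
  (Hb : forall f, ev f (wone A) = \sum_a \tr (b a *m psi a f))
  (v : forall a, 'cV[Cplx]_(na a)) (u : forall a, 'rV[Cplx]_(na a))
  (Hvu : forall e, b e != 0 -> b e = v e *m u e)
  (* fusion multiplicities and fusion tensors *)
  (N : I -> I -> I -> nat)
  (V : forall a b c, 'I_(N a b c) -> 'M[Cplx]_(na a * na b, na c))
  (W : forall a b c, 'I_(N a b c) -> 'M[Cplx]_(na c, na a * na b))
  (HVW : forall a b f, tens_rep A (psi a) (psi b) f
           = \sum_c \sum_(mu < N a b c) V a b c mu *m psi c f *m W a b c mu)
  (HWV1 : forall a b c (mu nu : 'I_(N a b c)),
           W a b c mu *m V a b c nu = (mu == nu)%:R%:M)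
  (HWV0 : forall a b c d (mu : 'I_(N a b c)) (nu : 'I_(N a b d)),
           c != d -> W a b c mu *m V a b d nu = 0)
  (* l_a and r_a *)
  (l r : I -> I)
  (Hl : forall a, b (l a) != 0 /\
          forall e c, b e != 0 -> N e a c = ((e == l a) && (a == c)) :> nat)
  (Hr : forall a, b (r a) != 0 /\
          forall e c, b e != 0 -> N a e c = ((e == r a) && (a == c)) :> nat)
  (* conjugation *)
  (bar : I -> I) (barK : forall a, bar (bar a) = a)
  (Z : forall a, 'M[Cplx]_(na a, na (bar a))) (Zi : forall a, 'M[Cplx]_(na (bar a), na a))
  (HZ : forall a, Z a *m Zi a = 1%:M /\ Zi a *m Z a = 1%:M)
  (HZconj : forall a f, (psi a (dS A f))^T = Z a *m psi (bar a) f *m Zi a)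
  (* w_c *)
  (w : I -> Cplx) (Hw0 : forall c, w c != 0)
  (theta : forall c, 'cV[Cplx]_(na (bar c) * na c))
  (Htheta : forall c (phi : 'rV[Cplx]_(na (bar c))),
      (phi *m vec_mx (theta c)^T)^T
        = castmx (f_equal na (barK c), erefl 1%N) (Zi (bar c) *m phi^T))
  (Hw : forall c (mu : 'I_(N (bar c) c (r c))),
      theta c *m mxvec (Z c)^T
        = w c *: ((V (bar c) c (r c) mu *m v (r c)) *m (u (r c) *m W (bar c) c (r c) mu)))
  (* d_a and g *)
  (d : I -> Cplx) (Hd : forall a, d a ^+ 2 = w a * w (bar a) /\ d a = d (bar a))
  (g : 'rV[Cplx]_n)
  (Hg : forall a, psi a g = (d a / w (bar a)) *:
          ((Zi a)^T *m castmx (erefl (na (bar a)), f_equal na (barK a)) (Z (bar a))))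
  (* spherical element k *)
  (k kinv : 'rV[Cplx]_n)
  (Hsph0 : forall e, b e != 0 -> (u e *m v e) 0 0 != 0)
  (Hpiv : pivotal A k kinv)
  (Hsph : forall a, \tr (psi a k) / (u (l a) *m v (l a)) 0 0
                    = \tr (psi a kinv) / (u (r a) *m v (r a)) 0 0)
  (xi : I -> Cplx) (Hxi : forall a, psi a k = xi a *: psi a g)
  (* Omega *)
  (Om : 'rV[Cplx]_n)
  (HOm : forall f, ev f Om = \sum_a ((\sum_(x | l x == l a) d x ^+ 2)^-1
                                     * (d a / xi a) * \tr (psi a f))) :
  [/\ elt_nondegenerate A Om, elt_cocommutative A Om, amul A Om Om = Om &
      exists T : 'M[Cplx]_n,
        [/\ forall x, tmul2 A (t2 (wone A) x) (comul A Om)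
                      = tmul2 A (t2 (x *m T) (wone A)) (comul A Om),
            forall x, comul A (x *m T)
                      = tsum3 (fun p q s => ev kinv q *: t2 (s *m T) (p *m T)) (comul2 A x),
            tsum2 (fun p q => ev kinv q *: (p *m T)) (comul A Om) = antip A Om &
            antip A Om = Om]].
Proof.
exact: (@spherical_Omega Cplx n A HA Hss I na psi Hrep Hirr Hdist Hcompl b Hb v u Hvu
  N V W HVW HWV1 l r Hl Hr bar barK Z Zi HZ HZconj w theta Hw0 Htheta Hw d Hd g Hg
  k kinv Hsph0 Hpiv Hsph xi Hxi Om HOm).
Qed.
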